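(* Let $\alpha\in[0,1)$ and let $K_\alpha(x,y)=\dfrac{1}{x^2+2\cos(\pi\alpha)xy+y^2}$ on $(0,+\infty)\times(0,+\infty)$. Then: (a) $K_\alpha\in \mathrm{STP}_\infty \iff K_\alpha\in\mathrm{SR}_\infty \iff \alpha\in\{1/2,1/3,\ldots,1/n,\ldots\}\cup\{0\}$. (b) For every integer $n\ge 2$: $K_\alpha\in\mathrm{TP}_n\iff K_\alpha\in\mathrm{SR}_n$, and $K_\alpha\in\mathrm{SR}_n \Rightarrow \big(\alpha\in\{1/2,1/3,\ldots,1/n\}$ or $\alpha<1/n\big)$. (c) For every integer $n\ge 2$: if $\alpha\le 1/n$ and $\alpha\le 1/(n^2-n-6)_+$ (with the convention $1/0=+\infty$), then $K_\alpha\in\mathrm{STP}_n$.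
   Context: For a real kernel $K$ on $I\times I$ ($I$ a real interval) and $n\in\{1,2,\ldots\}\cup\{\infty\}$: $K$ is $\mathrm{TP}_n$ (totally positive of order $n$) if $\det[K(x_i,y_j)]_{1\le i,j\le m}\ge 0$ for every finite $m\le n$ and all $x_1<\cdots<x_m$, $y_1<\cdots<y_m$ in $I$; $K$ is $\mathrm{SR}_n$ (sign-regular of order $n$) if there exist signs $\varepsilon_m\in\{-1,1\}$ ($m\le n$) such that $\varepsilon_m\det[K(x_i,y_j)]_{1\le i,j\le m}\ge0$ for all such $m$ and points. $\mathrm{STP}_n$ (resp. $\mathrm{SSR}_n$) means the same with all inequalities strict. $(a)_+=\max(a,0)$. *)

(* Defs.v *)
From mathcomp Require Import all_boot all_order all_algebra.
From mathcomp Require Import all_classical all_reals all_analysis.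
Set Implicit Arguments. Unset Strict Implicit. Unset Printing Implicit Defensive.
Import Order.TTheory GRing.Theory Num.Theory.
Local Open Scope ring_scope.

Section Defs.
Variable R : realType.

Definition Kalpha (alpha : R) (x y : R) : R :=
  (x ^+ 2 + 2 * cos (pi * alpha) * x * y + y ^+ 2)^-1.

Definition incr_pos (m : nat) (x : 'I_m -> R) : Prop :=
  (forall i, 0 < x i) /\ (forall i j : 'I_m, (i < j)%N -> x i < x j).

Definition kminor (K : R -> R -> R) (m : nat) (x y : 'I_m -> R) : R :=
  \det (\matrix_(i < m, j < m) K (x i) (y j)).

Definition TP (K : R -> R -> R) (n : nat) : Prop :=
  forall m, (1 <= m <= n)%N -> forall x y : 'I_m -> R,
    incr_pos x -> incr_pos y -> 0 <= kminor K x y.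

Definition STP (K : R -> R -> R) (n : nat) : Prop :=
  forall m, (1 <= m <= n)%N -> forall x y : 'I_m -> R,
    incr_pos x -> incr_pos y -> 0 < kminor K x y.

Definition SR (K : R -> R -> R) (n : nat) : Prop :=
  exists eps : nat -> R, (forall m, eps m = 1 \/ eps m = -1) /\
  forall m, (1 <= m <= n)%N -> forall x y : 'I_m -> R,
    incr_pos x -> incr_pos y -> 0 <= eps m * kminor K x y.

Definition SSR (K : R -> R -> R) (n : nat) : Prop :=
  exists eps : nat -> R, (forall m, eps m = 1 \/ eps m = -1) /\
  forall m, (1 <= m <= n)%N -> forall x y : 'I_m -> R,
    incr_pos x -> incr_pos y -> 0 < eps m * kminor K x y.

Definition TPinf (K : R -> R -> R) : Prop :=
  forall m, (1 <= m)%N -> forall x y : 'I_m -> R,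
    incr_pos x -> incr_pos y -> 0 <= kminor K x y.

Definition STPinf (K : R -> R -> R) : Prop :=
  forall m, (1 <= m)%N -> forall x y : 'I_m -> R,
    incr_pos x -> incr_pos y -> 0 < kminor K x y.

Definition SRinf (K : R -> R -> R) : Prop :=
  exists eps : nat -> R, (forall m, eps m = 1 \/ eps m = -1) /\
  forall m, (1 <= m)%N -> forall x y : 'I_m -> R,
    incr_pos x -> incr_pos y -> 0 <= eps m * kminor K x y.

End Defs.

(* Main.v *)
(** Write [theta = pi alpha] and [q = e^(i theta)].  A combination of the
    functions [1 / ((y + q x_i) (y + x_i / q))], [i < n], is shown to have at
    most [n - 1] positive zeros [y].  The induction runs through the kernels
    [1 / prod_(l < r) (y + q^(r - 1 - 2 l) x)]: dividing a combination of [n]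
    of them by one of its terms gives a real rational function [A / B], and
    taking its imaginary part on the ray [arg w = theta] gives, up to a positive
    factor, a combination of [n - 1] of the kernels of rank [r + 1].  This is
    the [theta]-analogue of differentiation, and the analogue of Rolle's theorem
    holds: if the imaginary part changes sign [m] times on the ray, then [A] has
    at most [m + 1] positive zeros.  Indeed, multiply [A / B] by
    [prod (w^kappa + p^kappa) / prod (w^kappa - y^kappa)], with
    [kappa = pi / theta], [p] the sign changes and [y] some [m + 1] zeros of
    [A]; the imaginary part of the product is nonnegative on the boundary of the
    sector, hence inside, so the product is monotone on the real axis beyond the
    [y]'s, while it tends to [0] at infinity; thus it has no further zero.

    The ranks stay in the admissible range [r theta < pi] when [n theta < pi];
    when [theta = pi / k] the kernel of rank [k] is [1 / (y^k + x^k)], which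
    settles all [n].  At [theta = 0] the ordinary Rolle theorem is used.

    Nonvanishing of all minors gives their positivity, since increasing tuples
    form a convex set and the minor at [x = y] a sparse geometric progression is
    positive.  The same minor forces every sign in the definition of [SR] to be
    [+1].  Conversely, if [m] is the least integer with [m alpha > 1], a minor of
    order [m] at nodes [x] close to [0] has the sign of
    [prod_(l <= m) sin (l theta)], which is negative. *)
Require Import Defs.
From mathcomp Require Import all_boot all_order all_algebra.
From mathcomp Require Import all_classical all_reals all_analysis.
From mathcomp Require Import complex ring lra.
Import Order.TTheory GRing.Theory Num.Theory.
Import numFieldNormedType.Exports.
Set Implicit Arguments. Unset Strict Implicit. Unset Printing Implicit Defensive.
Local Open Scope ring_scope.

Local Notation Re := complex.Re.
Local Notation Im := complex.Im.
Local Notation normc := ComplexField.Normc.normc.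
Local Notation "p ^:C" := (map_poly (real_complex _) p) (at level 2, format "p ^:C").

(** * Analytic functions on a strip *)

Section CurveDerivative.
Local Open Scope complex_scope.
Variable R : realType.
Local Notation C := R[i].

Lemma complexP (z w : C) : Re z = Re w -> Im z = Im w -> z = w.
Proof. by case: z w => a b [c d] /= -> ->. Qed.

Lemma ReD (z w : C) : Re (z + w) = Re z + Re w. Proof. by case: z w => a b []. Qed.
Lemma ImD (z w : C) : Im (z + w) = Im z + Im w. Proof. by case: z w => a b []. Qed.
Lemma ReM (z w : C) : Re (z * w) = Re z * Re w - Im z * Im w. Proof. by case: z w => a b []. Qed.
Lemma ImM (z w : C) : Im (z * w) = Re z * Im w + Im z * Re w. Proof. by case: z w => a b []. Qed.
Lemma ReN (z : C) : Re (- z) = - Re z. Proof. by case: z. Qed.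
Lemma ImN (z : C) : Im (- z) = - Im z. Proof. by case: z. Qed.
Lemma ReV (z : C) : Re z^-1 = Re z / (Re z ^+ 2 + Im z ^+ 2). Proof. by case: z. Qed.
Lemma ImV (z : C) : Im z^-1 = - (Im z / (Re z ^+ 2 + Im z ^+ 2)). Proof. by case: z. Qed.
Lemma sqnorm_neq0 (z : C) : z != 0 -> Re z ^+ 2 + Im z ^+ 2 != 0.
Proof.
case: z => a b; apply: contra => /= /eqP h.
by rewrite eq_complex /=; apply/andP; split; nra.
Qed.

(** Derivative of a curve in [C], kept as two real derivatives so that mean value and extremum
    arguments for real functions apply directly. *)
Definition cder (c : R -> C) (c' : C) (s : R) :=
  is_derive s 1 (fun s => Re (c s)) (Re c') /\ is_derive s 1 (fun s => Im (c s)) (Im c').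

Lemma is_derive1V (f : R -> R) (s d : R) : f s != 0 -> is_derive s 1 f d ->
  is_derive s 1 (fun s => (f s)^-1) (- (d / (f s) ^+ 2)).
Proof.
move=> fs0 [df <-]; apply: DeriveDef.
  exact: derivableV.
rewrite deriveV //. by rewrite /GRing.scale /= mulNr mulrC.
Qed.

Lemma cder_cst c s : cder (fun=> c) 0 s.
Proof. by split; exact: is_derive_cst. Qed.

Lemma cder_add c d c' d' s : cder c c' s -> cder d d' s -> cder (fun s => c s + d s) (c' + d') s.
Proof.
move=> [a1 a2] [b1 b2]; split; rewrite ?ReD ?ImD.
  by under eq_fun do rewrite ReD; exact: is_deriveD.
by under eq_fun do rewrite ImD; exact: is_deriveD.
Qed.

Lemma cder_mul c d c' d' s : cder c c' s -> cder d d' s ->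
  cder (fun s => c s * d s) (c' * d s + c s * d') s.
Proof.
move=> [a1 a2] [b1 b2]; split.
  under eq_fun do rewrite ReM.
  apply: is_derive_eq; rewrite ReD !ReM /GRing.scale /=; ring.
under eq_fun do rewrite ImM.
apply: is_derive_eq; rewrite ImD !ImM /GRing.scale /=; ring.
Qed.

Lemma cder_inv c c' s : c s != 0 -> cder c c' s ->
  cder (fun s => (c s)^-1) (- c' * ((c s)^-1 * (c s)^-1)) s.
Proof.
move=> c0 [a1 a2]; have n0 := sqnorm_neq0 c0.
have dN : is_derive s 1 (fun s => Re (c s) ^+ 2 + Im (c s) ^+ 2)
   (2 * Re (c s) * Re c' + 2 * Im (c s) * Im c').
  by apply: is_derive_eq; rewrite /GRing.scale /= ; ring.
have dV := @is_derive1V (fun s => Re (c s) ^+ 2 + Im (c s) ^+ 2) _ _ n0 dN.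
split.
  under eq_fun do rewrite ReV.
  apply: is_derive_eq; rewrite ReM !ReM !ImM !ReV !ImV /GRing.scale /=.
  case: (c s) c' n0 {a1 a2 dN dV} => a b [a' b'] /= n0; field; exact: n0.
under eq_fun do rewrite ImV.
apply: is_derive_eq; rewrite ImM !ReM !ImM !ReV !ImV /GRing.scale /=.
case: (c s) c' n0 {a1 a2 dN dV} => a b [a' b'] /= n0; field; exact: n0.
Qed.

End CurveDerivative.

(** * A minimum principle for harmonic functions on a strip *)

Section MinPrinciple.
Local Open Scope complex_scope.
Local Open Scope classical_set_scope.
Variable R : realType.

(** The one-sided form serves twice: against an interior minimum, and for the normal derivative on
    the real edge of the strip. *)
Lemma is_derive_near_lt (f : R -> R) (c d : R) : is_derive c 1 f d -> d < 0 ->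
  exists2 e, 0 < e & forall t, c < t < c + e -> f t < f c.
Proof.
move=> [df <-] d0.
have /cvgrPdist_lt/(_ _ (_ : 0 < - 'D_1 f c)) := df.
rewrite oppr_gt0 => /(_ d0) /nbhs_ballP[e /= e0 he].
exists e => // t /andP[ct te].
have := he (t - c); rewrite /ball /= sub0r normrN gtr0_norm ?subr_gt0 // ltrBlDl.
move=> /(_ te); rewrite subr_eq0 gt_eqF // => /(_ isT).
rewrite /GRing.scale /= mulr1 subrK => /ltr_normlP[]; rewrite opprB.
have ->: lim ((h^-1 *: (f (h *: 1 + c) - f c)) @[h --> 0^']) = 'D_1 f c by [].
rewrite ltrBlDl subrr => hlt _.
have tc0 : 0 < t - c by rewrite subr_gt0.
by move: hlt; rewrite mulrC pmulr_llt0 ?invr_gt0 // subr_lt0.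
Qed.

(** At the minimum [f1] vanishes; were [f2 < 0], [f1] would be negative just to the right of [c],
    and the mean value theorem would give a smaller value of [f] there. *)
Lemma second_derivative_test (f f1 : R -> R) (a b c f2 : R) :
  a < c < b -> (forall t, a < t < b -> is_derive t 1 f (f1 t)) ->
  is_derive c 1 f1 f2 -> (forall t, a < t < b -> f c <= f t) -> 0 <= f2.
Proof.
move=> /andP[ac cb] df df1 fmin.
have dfc : is_derive c 1 f 0.
  apply: (@derive1_at_min _ f a b); rewrite ?in_itv /= ?ac ?cb //.
  - by rewrite ltW // (lt_trans ac).
  - by move=> t; rewrite in_itv /= => /df [].
have f1c : f1 c = 0.
  have [_ <-] : is_derive c 1 f (f1 c) by apply: df; rewrite ac cb.
  by case: dfc => _ <-.
rewrite leNgt; apply/negP => f20.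
have [e e0 he] := is_derive_near_lt df1 f20.
set t := Num.min (c + e / 2) ((c + b) / 2).
have ct : c < t by rewrite /t lt_min; apply/andP; split; lra.
have tb : t < b by rewrite /t gt_min; apply/orP; right; lra.
have te : t < c + e by rewrite /t gt_min; apply/orP; left; lra.
have [|| x /[!in_itv] /= /andP[cx xt] ftc] := @MVT _ f f1 c t ct.
- move=> x; rewrite in_itv /= => /andP[cx xt]; apply: df.
  by rewrite (lt_trans ac cx) (lt_trans xt tb).
- apply: derivable_within_continuous => x; rewrite in_itv /= => /andP[cx xt].
  have [] // : is_derive x 1 f (f1 x).
  by apply: df; rewrite (lt_le_trans ac cx) (le_lt_trans xt tb).
have := fmin t; rewrite (lt_trans ac ct) tb => /(_ isT).
rewrite -subr_ge0 ftc pmulr_lge0 ?subr_gt0 //.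
have := he x; rewrite cx (lt_trans xt te) f1c => /(_ isT) h1.
by rewrite leNgt h1.
Qed.

(** The bound at infinity confines a negative minimum of a slightly perturbed function to a compact
    rectangle, and the boundary values push it into the interior, where the second derivative test
    applies in both directions. *)
Lemma strip_min_principle (th : R) (h hx hxx hy hyy : R -> R -> R) : 0 < th ->
  (forall t p : R, 0 <= p <= th -> forall e : R, 0 < e -> exists2 d, 0 < d &
     forall t' p', 0 <= p' <= th -> `|t' - t| < d -> `|p' - p| < d ->
       `|h t' p' - h t p| < e) ->
  (forall t p : R, 0 < p < th ->
     [/\ is_derive t 1 (fun s : R => h s p) (hx t p), is_derive p 1 (h t) (hy t p),
         is_derive t 1 (fun s : R => hx s p) (hxx t p), is_derive p 1 (hy t) (hyy t p)
       & hxx t p + hyy t p = 0]) ->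
  (forall t, 0 <= h t 0) -> (forall t, 0 <= h t th) ->
  (forall e : R, 0 < e -> exists M, forall t p : R, 0 <= p <= th -> M <= `|t| -> - e <= h t p) ->
  forall t p, 0 <= p <= th -> 0 <= h t p.
Proof.
move=> th0 hc hd h0 hth hinf t0 p0 p0th; rewrite leNgt; apply/negP => hneg.
set mu := - h t0 p0; have mu0 : 0 < mu by rewrite oppr_gt0.
have [M hM] := hinf (mu / 4) ltac:(lra).
(* [h - e p^2] still has a negative interior minimum, but a negative Laplacian *)
set e := mu / (4 * th ^+ 2); have th2 : 0 < th ^+ 2 by rewrite exprn_gt0.
have e0 : 0 < e by rewrite divr_gt0 // mulr_gt0.
have eth : e * th ^+ 2 = mu / 4 by rewrite /e; field; lra.
pose u (x : R * R) := h x.1 x.2 - e * x.2 ^+ 2.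
pose M' := Num.max M (`|t0| + 1).
have M't0 : `|t0| < M' by rewrite lt_max ltrDl ltr01 orbT.
have M'M : M <= M' by rewrite le_max lexx.
set A := `[- M', M'] `*` `[0, th].
have cA : compact A by apply: compact_setX; apply: segment_compact.
have Ap0 : A (t0, p0).
  by split => /=; rewrite in_itv //= -ler_norml ltW.
have cu : {within A, continuous u}.
  apply/subspace_continuousP => -[t p] [/= _ pth]; rewrite in_itv /= in pth.
  apply: (@cvgB _ R^o).
    apply/cvgrPdist_lt => r r0; rewrite near_withinE.
    have [d d0 hd'] := hc t p pth r r0.
    exists (ball t d, ball p d) => /=; first by split; exact: nbhsx_ballx.
    move=> [t' p'] [/= bt bp] [/= _]; rewrite in_itv /= => p'th.
    by rewrite distrC; apply: hd' => //; rewrite distrC.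
  apply: cvg_within_filter.
  apply: cvgM; first exact: cvg_cst.
  apply: (@cvg_comp _ _ _ snd (fun x : R => x ^+ 2) _ (nbhs p)).
    exact: cvg_snd.
  exact: exprn_continuous.
have [[tc pc] /[!inE] Ac umin] := compact_EVT_min (ex_intro _ _ Ap0) cA cu.
have ucle : u (tc, pc) <= - mu.
  apply: (le_trans (umin (t0, p0) _)); rewrite ?inE //= /u /= /mu opprK lerBlDr lerDl.
  by rewrite mulr_ge0 ?sqr_ge0 // ltW.
case: (Ac) => /= [] /[!in_itv] /= /andP[tc1 tc2] /andP[pc1 pc2].
(* The perturbation costs at most [mu / 4], so [h <= - (3 / 4) mu] at the minimum, below the bound
   [- mu / 4] that holds for large [|t|]. *)
have pcth : e * pc ^+ 2 <= mu / 4.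
  rewrite -eth ler_pM2l // ler_sqr ?nnegrE //; exact: le_trans pc2.
have hcle : h tc pc <= - (3 / 4) * mu.
  by move: ucle; rewrite /u /=; lra.
have tcM : `|tc| < M'.
  rewrite ltNge; apply/negP => Mtc.
  have := hM tc pc; rewrite pc1 pc2 (le_trans M'M Mtc) => /(_ isT isT); lra.
have pc0 : 0 < pc.
  rewrite lt_neqAle pc1 andbT; apply/eqP => pcE; have := h0 tc.
  by rewrite pcE; lra.
have pct : pc < th.
  rewrite lt_neqAle pc2 andbT; apply/eqP => pcE; have := hth tc.
  by rewrite -pcE; lra.
have [d1 d2 d3 d4 lap] := hd tc pc ltac:(by rewrite pc0 pct).
have hxx0 : 0 <= hxx tc pc.
  apply: (@second_derivative_test (h ^~ pc) (hx ^~ pc) (- M') M' tc) => //.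
  - by rewrite -ltr_norml.
  - by move=> t _; have [] := hd t pc ltac:(by rewrite pc0 pct).
  - move=> t /andP[tM1 tM2].
    have := umin (t, pc); rewrite /u /= inE lerD2r => /(_ _) -> //.
    by split; rewrite /= in_itv /= ?pc1 ?pc2 ?(ltW tM1) ?(ltW tM2).
have hyy0 : 0 <= hyy tc pc - e * 2.
  apply: (@second_derivative_test (fun p => h tc p - e * p ^+ 2)
     (fun p => hy tc p - e * (2 * p)) 0 th pc) => //.
  - by rewrite pc0 pct.
  - move=> p pp; have [_ dh _ _ _] := hd tc p pp.
    by apply: is_derive_eq; rewrite /GRing.scale /=; ring.
  - by apply: is_derive_eq; rewrite /GRing.scale /=; ring.
  - move=> p /andP[p1 p2].
    have := umin (tc, p); rewrite /u /= inE => -> //.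
    by split; rewrite /= in_itv /= ?tc1 ?tc2 ?(ltW p1) ?(ltW p2).
by move: lap hxx0 hyy0 e0; lra.
Qed.
End MinPrinciple.

(** * Expressions in [e^s] and [e^(kappa s)]: derivatives and limits *)

Section StripExpressions.
Local Open Scope complex_scope.
Local Open Scope classical_set_scope.
Variables (R : realType) (kappa : R).
Local Notation C := R[i].

(* Expressions in [e^s] ([Ex false]) and [e^(kappa s)] ([Ex true]), [s = t + i p]:
   as their complex derivatives are again expressions, one induction gives
   derivatives of all orders. *)
Inductive sexp := Cst of C | Ex of bool | Add of sexp & sexp | Mul of sexp & sexp | Inv of sexp.

Fixpoint subst (v : bool -> C) (e : sexp) : C :=
  match e with
  | Cst c => c
  | Ex b => v b
  | Add e f => subst v e + subst v f
  | Mul e f => subst v e * subst v f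
  | Inv e => (subst v e)^-1
  end.

(** Excludes the default value [0^-1 = 0], at which an expression need not be analytic. *)
Fixpoint invertible (v : bool -> C) (e : sexp) : Prop :=
  match e with
  | Cst _ | Ex _ => True
  | Add e f | Mul e f => invertible v e /\ invertible v f
  | Inv e => invertible v e /\ subst v e != 0
  end.

Definition cexp (t p : R) : C := (expR t * cos p) +i* (expR t * sin p).
Definition rate (b : bool) : R := if b then kappa else 1.
Definition at_pt (t p : R) (b : bool) : C := cexp (rate b * t) (rate b * p).

Fixpoint sderiv (e : sexp) : sexp :=
  match e with
  | Cst _ => Cst 0
  | Ex b => Mul (Cst (rate b)%:C) (Ex b)
  | Add e f => Add (sderiv e) (sderiv f)
  | Mul e f => Add (Mul (sderiv e) f) (Mul e (sderiv f))
  | Inv e => Mul (Mul (Cst (-1)) (sderiv e)) (Mul (Inv e) (Inv e))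
  end.

(** Differentiating [Inv e] inverts only [e] again, so one condition serves derivatives of all
    orders. *)
Lemma invertible_sderiv v e : invertible v e -> invertible v (sderiv e).
Proof.
by elim: e => //= [e ie f jf [/ie ? /jf ?]
  |e ie f jf [/[dup] ? /ie ? /[dup] ? /jf ?]|e ie [/[dup] ? /ie]].
Qed.

Lemma is_derive_scale (f : R -> R) (k s d : R) :
  is_derive (k * s) 1 f d -> is_derive s 1 (fun s => f (k * s)) (k * d).
Proof.
move=> h; have hk : is_derive s 1 (fun s : R => k * s) k.
  by apply: is_derive_eq; rewrite /GRing.scale /= mulr1.
by have := is_derive1_comp h hk; rewrite mulrC.
Qed.

Lemma cder_cexp_t k p s : cder (fun s => cexp (k * s) p) (k%:C * cexp (k * s) p) s.
Proof.
have h := is_derive_scale (is_derive_expR (k * s)).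
split; rewrite ?ReM ?ImM /=; apply: is_derive_eq; rewrite /GRing.scale /=; ring.
Qed.

Lemma cder_cexp_p k t s :
  cder (fun s => cexp t (k * s)) (k%:C * cexp t (k * s) * 'i) s.
Proof.
have h := is_derive_scale (is_derive_cos (k * s)).
have h' := is_derive_scale (is_derive_sin (k * s)).
by split; rewrite !(ReM, ImM) /=; apply: is_derive_eq; rewrite /GRing.scale /=; ring.
Qed.

(** Chain rule in the direction [dir]: with [dir = 1] for [t] and [dir = 'i] for [p], both partial
    derivatives come from one formal derivative, which is the content of the Cauchy-Riemann
    equations. *)
Lemma cder_subst (u : R -> bool -> C) (dir : C) (s : R) (e : sexp) :
  (forall b, cder (u^~ b) ((rate b)%:C * u s b * dir) s) -> invertible (u s) e ->
  cder (fun s => subst (u s) e) (subst (u s) (sderiv e) * dir) s.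
Proof.
move=> hu; elim: e => /=.
- by move=> c _; rewrite mul0r; exact: cder_cst.
- by move=> b _; exact: hu.
- by move=> e ie f jf [/ie he /jf hf]; rewrite mulrDl; exact: cder_add.
- move=> e ie f jf [/ie he /jf hf]; have := cder_mul he hf.
  by congr cder; ring.
- move=> e ie [/ie he e0]; have := cder_inv e0 he.
  by congr cder; ring.
Qed.

Lemma cder_at_pt_t p t e : invertible (at_pt t p) e ->
  cder (fun t => subst (at_pt t p) e) (subst (at_pt t p) (sderiv e)) t.
Proof.
move=> he; rewrite -[subst _ (sderiv e)]mulr1.
apply: (@cder_subst (fun t => at_pt t p)) => // b.
by rewrite mulr1; exact: cder_cexp_t.
Qed.

Lemma cder_at_pt_p t p e : invertible (at_pt t p) e ->
  cder (fun p => subst (at_pt t p) e) (subst (at_pt t p) (sderiv e) * 'i) p.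
Proof.
by move=> he; apply: (@cder_subst (at_pt t)) => // b; exact: cder_cexp_p.
Qed.

Definition ccvg (T : Type) (F : set_system T) (f : T -> C) (z : C) :=
  (fun q => Re (f q)) @ F --> Re z /\ (fun q => Im (f q)) @ F --> Im z.

(** The filter is arbitrary because the limit is taken both at points of the strip and at its left
    end. *)
Lemma ccvg_subst (T : Type) (F : set_system T) {FF : Filter F}
    (u : T -> bool -> C) (v : bool -> C) (e : sexp) :
  (forall b, ccvg F (u^~ b) (v b)) -> invertible v e ->
  ccvg F (fun q => subst (u q) e) (subst v e).
Proof.
move=> hu; elim: e => /=.
- by move=> c _; split; exact: cvg_cst.
- by move=> b _; exact: hu.
- move=> e ie f jf [/ie[? ?] /jf[? ?]]; split; rewrite ?(ReD, ImD).
    by under eq_fun do rewrite ReD; exact: (@cvgD _ R^o).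
  by under eq_fun do rewrite ImD; exact: (@cvgD _ R^o).
- move=> e ie f jf [/ie[? ?] /jf[? ?]]; split; rewrite ?(ReM, ImM).
    by under eq_fun do rewrite ReM; apply: (@cvgB _ R^o); exact: cvgM.
  by under eq_fun do rewrite ImM; apply: (@cvgD _ R^o); exact: cvgM.
- move=> e ie [/ie[hr hi] e0].
  have n0 := sqnorm_neq0 e0.
  have hn : (fun q => (Re (subst (u q) e) ^+ 2 + Im (subst (u q) e) ^+ 2)^-1) @ F -->
     (Re (subst v e) ^+ 2 + Im (subst v e) ^+ 2)^-1.
    by apply: cvgV => //; under eq_fun do rewrite !expr2;
       rewrite !expr2; apply: (@cvgD _ R^o); exact: cvgM.
  split; rewrite ?(ReV, ImV).
    by under eq_fun do rewrite ReV; exact: cvgM.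
  by under eq_fun do rewrite ImV; apply: (@cvgN _ R^o); exact: cvgM.
Qed.

Lemma ccvg_cexp (a b t p : R) :
  ccvg (nbhs (t, p)) (fun q => cexp (a * q.1) (b * q.2)) (cexp (a * t) (b * p)).
Proof.
have c1 : (fun q : R * R => expR (a * q.1)) @ (nbhs (t, p)) --> expR (a * t).
  apply: (@cvg_comp _ _ _ (fun q : R * R => a * q.1) (@expR R) _ (nbhs (a * t))).
    by apply: cvgM; [exact: cvg_cst|exact: cvg_fst].
  exact: continuous_expR.
have c2 f : continuous f -> (fun q : R * R => f (b * q.2)) @ (nbhs (t, p)) --> (f (b * p) : R).
  move=> cf; apply: (@cvg_comp _ _ _ (fun q : R * R => b * q.2) f _ (nbhs (b * p))).
    by apply: cvgM; [exact: cvg_cst|exact: cvg_snd].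
  exact: cf.
split => /=; apply: cvgM => //; apply: c2; [exact: continuous_cos|exact: continuous_sin].
Qed.

Lemma ccvg_at_pt t p e : invertible (at_pt t p) e ->
  ccvg (nbhs (t, p)) (fun q => subst (at_pt q.1 q.2) e) (subst (at_pt t p) e).
Proof. by move=> he; apply: ccvg_subst => // b; exact: ccvg_cexp. Qed.

(** The filter of [t -> -oo] uniformly in [p], that is, of [e^s -> 0]. *)
Definition near_left_end : set_system (R * R) :=
  [set P | exists M, forall t p, t <= M -> P (t, p)].

Global Instance near_left_end_filter : Filter near_left_end.
Proof.
split.
- by exists 0.
- move=> P Q [M hM] [N hN]; exists (Num.min M N) => t p.
  by rewrite le_min => /andP[/hM ? /hN ?]; split.
- by move=> P Q PQ [M hM]; exists M => t p /hM /PQ.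
Qed.

(** Cosine and sine are bounded and both rates are positive, so both exponentials tend to [0]
    uniformly in [p]; limits are read off by substituting [0]. *)
Lemma ccvg_left_end (e : sexp) : 0 < kappa -> invertible (fun=> 0) e ->
  ccvg near_left_end (fun q => subst (at_pt q.1 q.2) e) (subst (fun=> 0) e).
Proof.
move=> k0 he; apply: ccvg_subst => // b.
have b0 : 0 < rate b by case: b.
have hb f : (forall x, `|f x| <= 1) ->
    (fun q : R * R => expR (rate b * q.1) * f (rate b * q.2)) @ near_left_end --> (0 : R).
  move=> f1; apply/cvgrPdist_lt => eps e0.
  (* The [- 1] makes the final inequality strict. *)
  exists ((ln eps - 1) / rate b) => t p tM /=.
  rewrite sub0r normrN normrM gtr0_norm ?expR_gt0 //.
  apply: (@le_lt_trans _ _ (expR (rate b * t))).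
    by rewrite ler_piMr ?expR_ge0.
  rewrite -[ltRHS]lnK ?posrE // ltr_expR.
  have : rate b * t <= rate b * ((ln eps - 1) / rate b) by rewrite ler_pM2l.
  have -> : rate b * ((ln eps - 1) / rate b) = ln eps - 1 by field; rewrite gt_eqF.
  lra.
split; apply: hb => x; rewrite ler_norml.
  by rewrite cos_geN1 cos_le1.
by rewrite sin_geN1 sin_le1.
Qed.

End StripExpressions.

(** * Rolle's theorem for a sector *)

Section RemovableSingularity.
Local Open Scope complex_scope.
Local Open Scope classical_set_scope.
Variables (R : realType) (kappa : R).
Local Notation C := R[i].

Lemma normcE2 (z : C) : normc z = Num.sqrt (Re z ^+ 2 + Im z ^+ 2).
Proof. by case: z. Qed.

Lemma normc_ge0 (z : C) : 0 <= normc z.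
Proof. by rewrite normcE2 sqrtr_ge0. Qed.

Lemma Re_le_normc (z : C) : `|Re z| <= normc z.
Proof. by rewrite normcE2 -sqrtr_sqr ler_wsqrtr // lerDl sqr_ge0. Qed.

Lemma Im_le_normc (z : C) : `|Im z| <= normc z.
Proof. by rewrite normcE2 -sqrtr_sqr ler_wsqrtr // lerDr sqr_ge0. Qed.

Lemma normc_le (z : C) : normc z <= `|Re z| + `|Im z|.
Proof.
rewrite normcE2 -[leRHS]ger0_norm ?addr_ge0 // -sqrtr_sqr ler_wsqrtr //.
rewrite sqrrD !real_normK ?num_real //.
have := mulr_ge0 (normr_ge0 (Re z)) (normr_ge0 (Im z)); lra.
Qed.

Lemma normcC (x : R) : normc x%:C = `|x|.
Proof. by rewrite normcE2 /= expr0n /= addr0 sqrtr_sqr. Qed.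

Lemma normc_cexp (t p : R) : normc (cexp t p) = expR t.
Proof.
rewrite normcE2 /= !exprMn -mulrDr cos2Dsin2 mulr1 sqrtr_sqr ger0_norm //.
Qed.

Lemma normc_ccvg (T : Type) (F : set_system T) {FF : Filter F} (f : T -> C) (z : C) :
  (forall e, 0 < e -> \forall q \near F, normc (f q - z) < e) -> ccvg F f z.
Proof.
move=> H; split; apply/cvgrPdist_lt => e e0; apply: filterS (H e e0) => q hq;
  rewrite distrC; apply: le_lt_trans hq.
  by have := Re_le_normc (f q - z); rewrite ReD ReN.
by have := Im_le_normc (f q - z); rewrite ImD ImN.
Qed.

Lemma is_derive_littleo (f : R -> R) (c d : R) : is_derive c 1 f d ->
  forall e, 0 < e -> exists2 r, 0 < r & forall t, `|t - c| < r ->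
    `|f t - f c - d * (t - c)| <= e * `|t - c|.
Proof.
move=> [df <-] e e0.
have /cvgrPdist_lt/(_ e e0)/nbhs_ballP[r /= r0 hr] := df.
exists r => // t tr; have [->|tc] := eqVneq t c.
  by rewrite !subrr mulr0 subr0 normr0 mulr0.
have tc0 : t - c != 0 by rewrite subr_eq0.
have := hr (t - c); rewrite /ball /= sub0r normrN => /(_ tr tc0).
rewrite /GRing.scale /= mulr1 subrK => /ltW.
rewrite -(ler_pM2r (_ : 0 < `|t - c|)) ?normr_gt0 // -normrM.
move=> h; apply: le_trans h; rewrite le_eqVlt; apply/orP; left; apply/eqP.
rewrite -normrN; congr Num.norm; rewrite -[lim _]/('D_1 f c); field.
exact: tc0.
Qed.

Lemma cexp_littleo (e : R) : 0 < e -> exists2 r, 0 < r &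
  forall t p, `|t| < r -> `|p| < r ->
    normc (cexp t p - 1 - (t +i* p)) <= e * (`|t| + `|p|).
Proof.
(* The errors below add up to [e' |t| + (3 + 3 + 2) e' |p|], whence the [8]. *)
move=> e0; have [e' [e8 e'1 e'e]] : exists e', [/\ 0 < e', e' <= 1 & e' <= e / 8].
  exists (Num.min (e / 8) 1); split; rewrite ?ge_min ?lexx ?orbT //.
  by rewrite lt_min ltr01 andbT divr_gt0.
have [r1 r10 h1] := is_derive_littleo (is_derive_expR (0 : R)) e8.
have [r2 r20 h2] := is_derive_littleo (is_derive_cos (0 : R)) e8.
have [r3 r30 h3] := is_derive_littleo (is_derive_sin (0 : R)) e8.
exists (Num.min (Num.min r1 r2) (Num.min r3 e')) => [|t p].
  by rewrite !lt_min r10 r20 r30 e8.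
rewrite !lt_min => /andP[/andP[t1 _] /andP[_ te]] /andP[/andP[_ p2] /andP[p3 pe]].
have := h1 t; rewrite subr0 expR0 mul1r => /(_ t1) {}h1.
have := h2 p; rewrite subr0 cos0 sin0 oppr0 mul0r subr0 => /(_ p2) {}h2.
have := h3 p; rewrite subr0 cos0 sin0 mul1r subr0 => /(_ p3) {}h3.
have a0 := normr_ge0 t; have b0 := normr_ge0 p.
have E1 : `|expR t - 1| <= 2 * `|t|.
  have -> : expR t - 1 = (expR t - 1 - t) + t by ring.
  apply: (le_trans (ler_normD _ _)); have : e' * `|t| <= `|t| by rewrite ler_piMl.
  move: h1; lra.
have E2 : `|expR t| <= 3.
  have -> : expR t = (expR t - 1) + 1 by ring.
  by apply: (le_trans (ler_normD _ _)); rewrite normr1; move: E1 te; lra.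
apply: (le_trans (normc_le _)).
rewrite !(ReD, ImD) /=.
have -> : expR t * cos p + - 1 + - t = (expR t - 1 - t) + expR t * (cos p - 1) by ring.
have -> : expR t * sin p + - 0 + - p = expR t * (sin p - p) + (expR t - 1) * p by ring.
have T1 := ler_normD (expR t - 1 - t) (expR t * (cos p - 1)).
have T2 := ler_normD (expR t * (sin p - p)) ((expR t - 1) * p).
have M1 : `|expR t * (cos p - 1)| <= 3 * (e' * `|p|).
  by rewrite normrM; apply: ler_pM.
have M2 : `|expR t * (sin p - p)| <= 3 * (e' * `|p|).
  by rewrite normrM; apply: ler_pM.
have M3 : `|(expR t - 1) * p| <= 2 * e' * `|p|.
  rewrite normrM; apply: ler_pM => //; apply: (le_trans E1).
  by rewrite ler_pM2l //; exact: ltW.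
have A1 : e' * `|t| <= e / 8 * `|t| by rewrite ler_wpM2r.
have A2 : e' * `|p| <= e / 8 * `|p| by rewrite ler_wpM2r.
have A3 : 0 <= e * `|t| by rewrite mulr_ge0 // ltW.
move: T1 T2 M1 M2 M3 A1 A2 A3 h1 h2; nra.
Qed.

Lemma cexpD (a b c d : R) : cexp (a + c) (b + d) = cexp a b * cexp c d.
Proof. by apply: complexP; rewrite ?ReM ?ImM /= expRD ?cosD ?sinD; ring. Qed.

(* A removable singularity; the punctured filter avoids the junk value [x / 0 = 0] at [(tau, 0)]. *)
Lemma chi_cvg (tau : R) : 0 < kappa ->
  ccvg (tau, 0)^' (fun q : R * R => (cexp q.1 q.2 - (expR tau)%:C) /
      (cexp (kappa * q.1) (kappa * q.2) - (expR (kappa * tau))%:C))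
    ((expR tau / (kappa * expR (kappa * tau)))%:C).
Proof.
move=> k0; set c := expR tau / expR (kappa * tau).
have c0 : 0 < c by rewrite divr_gt0 ?expR_gt0.
suff H : forall e, 0 < e -> \forall q \near (tau, 0)^',
   normc ((cexp q.1 q.2 - (expR tau)%:C) / (cexp (kappa * q.1) (kappa * q.2)
     - (expR (kappa * tau))%:C) - (expR tau / (kappa * expR (kappa * tau)))%:C) < e.
  exact: normc_ccvg.
move=> e e0.
(* [e' <= 1 / 4] keeps the denominator [b] at least [kappa N / 4] in modulus; the error is then at
   most [8 e' c / kappa], and the [17] bounds this by [8 e / 17 < e]. *)
have [e' [e'0 e'4 e'e]] : exists e',
    [/\ 0 < e', e' <= 1 / 4 & e' <= e * kappa / (17 * c)].
  exists (Num.min (1 / 4) (e * kappa / (17 * c))).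
  split; rewrite ?ge_min ?lexx ?orbT //.
  rewrite lt_min; apply/andP; split; first by lra.
  by apply: divr_gt0; apply: mulr_gt0.
have [r r0 hr] := cexp_littleo e'0.
set r' := Num.min r (r / kappa).
have r'0 : 0 < r' by rewrite lt_min r0 divr_gt0.
rewrite near_withinE.
exists (ball tau r', ball (0 : R) r'); first by split; exact: nbhsx_ballx.
move=> [t p] [bt bp]; rewrite xpair_eqE negb_and => tp.
change (normc ((cexp t p - (expR tau)%:C) / (cexp (kappa * t) (kappa * p)
     - (expR (kappa * tau))%:C) - (expR tau / (kappa * expR (kappa * tau)))%:C) < e).
rewrite /ball /= sub0r normrN in bp; rewrite /ball /= distrC in bt.
set s := t - tau; rewrite -/s in bt.
have E1 : cexp t p = cexp s p * cexp tau 0 by rewrite -cexpD addr0 subrK.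
have E2 : cexp (kappa * t) (kappa * p) =
    cexp (kappa * s) (kappa * p) * cexp (kappa * tau) 0.
  by rewrite -cexpD addr0 -mulrDr subrK.
have cexp0 u : cexp u 0 = (expR u)%:C.
  by apply: complexP; rewrite /= ?cos0 ?sin0 ?mulr1 ?mulr0.
have ->: cexp t p - (expR tau)%:C = (expR tau)%:C * (cexp s p - 1).
  by rewrite E1 cexp0; ring.
have ->: cexp (kappa * t) (kappa * p) - (expR (kappa * tau))%:C =
   (expR (kappa * tau))%:C * (cexp (kappa * s) (kappa * p) - 1).
  by rewrite E2 cexp0; ring.
set a := cexp s p - 1; set b := cexp (kappa * s) (kappa * p) - 1.
set N := `|s| + `|p|.
have N0 : 0 < N.
  case/orP: tp => h.
    by rewrite ltr_wpDr // normr_gt0 /s subr_eq0.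
  by rewrite ltr_wpDl // normr_gt0.
have ha : normc (a - (s +i* p)) <= e' * N.
  by apply: hr; [move: bt|move: bp]; rewrite lt_min => /andP[].
have hb : normc (b - (kappa * s +i* (kappa * p))) <= e' * (kappa * N).
  have := hr (kappa * s) (kappa * p); rewrite !normrM (gtr0_norm k0) -mulrDr; apply.
    by move: bt; rewrite lt_min => /andP[_]; rewrite ltr_pdivlMr // mulrC.
  by move: bp; rewrite lt_min => /andP[_]; rewrite ltr_pdivlMr // mulrC.
have kN0 : 0 < kappa * N by rewrite mulr_gt0.
have hb' : kappa * N / 4 <= normc b.
  have /le_trans/(_ hb) h1 := Re_le_normc (b - (kappa * s +i* (kappa * p))).
  have /le_trans/(_ hb) h2 := Im_le_normc (b - (kappa * s +i* (kappa * p))).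
  have h3 := Re_le_normc b; have h4 := Im_le_normc b.
  rewrite ReD /= in h1; rewrite ImD /= in h2.
  have h5 : `|kappa * s| <= `|Re b| + e' * (kappa * N).
    rewrite (_ : kappa * s = Re b - (Re b + - (kappa * s))); last by ring.
    by apply: (le_trans (ler_normB _ _)); rewrite lerD2l.
  have h6 : `|kappa * p| <= `|Im b| + e' * (kappa * N).
    rewrite (_ : kappa * p = Im b - (Im b + - (kappa * p))); last by ring.
    by apply: (le_trans (ler_normB _ _)); rewrite lerD2l.
  have h7 : e' * (kappa * N) <= 1 / 4 * (kappa * N) by rewrite ler_pM2r.
  have h8 : kappa * N = `|kappa * s| + `|kappa * p|.
    by rewrite !normrM (gtr0_norm k0) -mulrDr.
  move: h3 h4 h5 h6 h7; rewrite h8; lra.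
have b0 : b != 0.
  by apply/eqP => b0; move: hb'; rewrite b0 ComplexField.Normc.normc0; lra.
have ekt : (expR (kappa * tau))%:C != 0 :> C by rewrite eq_complex /= gt_eqF ?expR_gt0.
have kC : kappa%:C != 0 :> C by rewrite eq_complex /= gt_eqF.
have -> : (expR tau)%:C * a / ((expR (kappa * tau))%:C * b) -
    (expR tau / (kappa * expR (kappa * tau)))%:C =
  c%:C / kappa%:C * ((kappa%:C * (a - (s +i* p)) - (b - (kappa * s +i* (kappa * p)))) / b).
  rewrite /c !rmorphM !fmorphV !rmorphM /=.
  have -> : kappa * s +i* (kappa * p) = kappa%:C * (s +i* p) :> C.
    by apply: complexP; rewrite !(ReM, ImM) /=; ring.
  by field; rewrite ekt kC b0.
rewrite !ComplexField.Normc.normcM !ComplexField.Normc.normcV !normcC !gtr0_norm //.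
have nb0 : 0 < normc b by apply: lt_le_trans hb'; rewrite divr_gt0.
have hnum : normc (kappa%:C * (a - (s +i* p)) - (b - (kappa * s +i* (kappa * p)))) <=
   2 * (e' * (kappa * N)).
  apply: (le_trans (le_normcD _ _)).
  rewrite complex.normcN ComplexField.Normc.normcM normcC gtr0_norm //.
  by move: hb; have : kappa * normc (a - (s +i* p)) <= kappa * (e' * N);
     [rewrite ler_pM2l|lra].
have hq : normc (kappa%:C * (a - (s +i* p)) - (b - (kappa * s +i* (kappa * p)))) / normc b
   <= 8 * e'.
  rewrite ler_pdivrMr //; apply: (le_trans hnum).
  have : e' * (kappa * N / 4) <= e' * normc b by rewrite ler_pM2l.
  lra.
apply: (@le_lt_trans _ _ (c / kappa * (8 * e'))).
  by rewrite ler_pM2l // divr_gt0.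
apply: (@le_lt_trans _ _ (c / kappa * (8 * (e * kappa / (17 * c))))).
  by rewrite !ler_pM2l // divr_gt0.
have -> : c / kappa * (8 * (e * kappa / (17 * c))) = e * (8 / 17).
  by field; rewrite !gt_eqF.
by rewrite gtr_pMr //; lra.
Qed.
End RemovableSingularity.

(** * Rational functions of [e^s] and [e^(kappa s)], and their decay *)

Section RationalExpressions.
Local Open Scope complex_scope.
Local Open Scope classical_set_scope.
Variables (R : realType).
Local Notation C := R[i].

Definition polyE (p : {poly R}) : sexp R :=
  foldr (fun a e => Add (Mul e (Ex R false)) (Cst a%:C)) (Cst 0) p.
Definition prodW (zs : seq R) : sexp R :=
  foldr (fun z e => Mul (Add (Ex R true) (Cst z%:C)) e) (Cst 1) zs.
Definition prodV (ys : seq R) : sexp R :=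
  foldr (fun y e => Mul (Inv (Add (Ex R true) (Cst (- y)%:C))) e) (Cst 1) ys.
(** With [w = e^s] and [W = e^(kappa s)]: [A(w) / B(w)] times [prod (W + z) / prod (W - y)], the
    auxiliary function of the sector argument. *)
Definition ratE (A B : {poly R}) (zs ys : seq R) : sexp R :=
  Mul (Mul (polyE A) (Inv (polyE B))) (Mul (prodW zs) (prodV ys)).

Lemma subst_polyE v p : subst v (polyE p) = p^:C.[v false].
Proof. by rewrite map_polyE horner_Poly /polyE; elim: (p : seq R) => //= a s ->. Qed.

Lemma subst_prodW v zs : subst v (prodW zs) = \prod_(z <- zs) (v true + z%:C).
Proof. by elim: zs => [|z zs IH] /=; rewrite ?big_nil // big_cons IH. Qed.

Lemma subst_prodV v ys : subst v (prodV ys) = \prod_(y <- ys) (v true - y%:C)^-1.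
Proof.
by elim: ys => [|y ys IH] /=; rewrite ?big_nil // big_cons IH rmorphN.
Qed.

Lemma subst_ratE v A B zs ys : subst v (ratE A B zs ys) =
  (A^:C.[v false] / B^:C.[v false]) *
  ((\prod_(z <- zs) (v true + z%:C)) * \prod_(y <- ys) (v true - y%:C)^-1).
Proof. by rewrite /= !subst_polyE subst_prodW subst_prodV. Qed.

Lemma invertible_ratE v A B zs ys : B^:C.[v false] != 0 ->
  (forall y, y \in ys -> v true != y%:C) -> invertible v (ratE A B zs ys).
Proof.
move=> B0 hy; have hp p : invertible v (polyE p).
  by rewrite /polyE; elim: (p : seq R) => //=.
split; first by rewrite /= subst_polyE.
split; first by elim: (zs).
elim: ys hy => //= y ys IH hy; split; last first.
  by apply: IH => z zy; apply: hy; rewrite inE zy orbT.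
split => //; rewrite rmorphN subr_eq0; apply: hy.
by rewrite inE eqxx.
Qed.

Lemma Im_ratE v A B zs ys : (forall b, Im (v b) = 0) ->
  Im (subst v (ratE A B zs ys)) = 0.
Proof.
move=> hv; have vE b : exists a, v b = a%:C by exists (Re (v b)); exact: complexP.
have [[a ha] [b hb]] := (vE true, vE false).
rewrite subst_ratE ha hb !horner_map /= -fmorphV -rmorphM /=.
under eq_bigr do rewrite -rmorphD /=.
under [X in _ * (_ * X)]eq_bigr do rewrite -rmorphB -fmorphV /=.
by rewrite -!rmorph_prod -!rmorphM.
Qed.

Lemma normc_sum (I : Type) (s : seq I) (F : I -> C) :
  normc (\sum_(i <- s) F i) <= \sum_(i <- s) normc (F i).
Proof.
elim: s => [|i s IH]; first by rewrite !big_nil ComplexField.Normc.normc0.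
by rewrite !big_cons; apply: (le_trans (le_normcD _ _)); rewrite lerD2l.
Qed.

Lemma normcX (z : C) n : normc (z ^+ n) = normc z ^+ n.
Proof.
elim: n => [|n IH]; first by rewrite !expr0 ComplexField.Normc.normc1.
by rewrite !exprS ComplexField.Normc.normcM IH.
Qed.

Lemma normc_prod (I : Type) (s : seq I) (F : I -> C) :
  normc (\prod_(i <- s) F i) = \prod_(i <- s) normc (F i).
Proof.
elim: s => [|i s IH]; first by rewrite !big_nil ComplexField.Normc.normc1.
by rewrite !big_cons ComplexField.Normc.normcM IH.
Qed.

Lemma poly_growth (p : {poly R}) d : (size p <= d.+1)%N ->
  exists2 M, 0 < M & forall z : C, 1 <= normc z -> normc p^:C.[z] <= M * normc z ^+ d.
Proof.
move=> sp; exists (1 + \sum_(i < d.+1) `|p`_i|).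
  by rewrite ltr_wpDr ?sumr_ge0.
move=> z z1; rewrite (horner_coef_wide _ (n := d.+1)); last by rewrite size_map_poly.
apply: (le_trans (normc_sum _ _)); rewrite mulrDl mul1r ler_wpDl ?exprn_ge0 ?normc_ge0 //.
rewrite mulr_suml; apply: ler_sum => i _.
rewrite ComplexField.Normc.normcM normcX coef_map normcC ler_wpM2l //.
by rewrite ler_weXn2l // -ltnS.
Qed.

Lemma poly_growth_lower (p : {poly R}) : p != 0 ->
  exists M m, [/\ 1 <= M, 0 < m & forall z : C, M <= normc z ->
    m * normc z ^+ (size p).-1 <= normc p^:C.[z]].
Proof.
move=> p0; set d := (size p).-1.
have sp : size p = d.+1 by rewrite prednK // lt0n size_poly_eq0.
set q := p - lead_coef p *: 'X^d.
(* The factor ['X] expresses that [q] has degree below [d] without subtracting from [d], which may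
   be [0]. *)
have sq : (size (q * 'X)%R <= d.+1)%N.
  have [->|q0] := eqVneq q 0; first by rewrite mul0r size_poly0.
  rewrite size_mulX // ltnS; apply/leq_sizeP => j; rewrite leq_eqVlt => /orP[/eqP<-|dj].
    by rewrite !coefE eqxx mulr1 lead_coefE -/d subrr.
  by rewrite !coefE gtn_eqF // mulr0 subr0 nth_default // sp.
have [M M0 hM] := poly_growth sq.
have l0 : 0 < `|lead_coef p| by rewrite normr_gt0 lead_coef_eq0.
exists (Num.max 1 (2 * M / `|lead_coef p|)), (`|lead_coef p| / 2).
split; [by rewrite le_max lexx|by rewrite divr_gt0|move=> z].
rewrite ge_max => /andP[z1 zM].
have z0 : 0 < normc z by apply: lt_le_trans z1.
have := hM z z1; rewrite rmorphM /= map_polyX hornerM hornerX.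
rewrite ComplexField.Normc.normcM => hq.
have pE : p = lead_coef p *: 'X^d + q by rewrite /q addrC subrK.
have T : `|lead_coef p| * normc z ^+ d <= normc p^:C.[z] + normc q^:C.[z].
  have -> : `|lead_coef p| * normc z ^+ d = normc (p^:C.[z] - q^:C.[z]).
    rewrite {2}pE rmorphD /= hornerD addrK map_polyZ map_polyXn hornerZ hornerXn.
    by rewrite ComplexField.Normc.normcM normcX normcC.
  by apply: (le_trans (le_normcD _ _)); rewrite complex.normcN.
have hq2 : normc q^:C.[z] <= `|lead_coef p| / 2 * normc z ^+ d.
  rewrite -(ler_pM2r z0); apply: (le_trans hq).
  rewrite mulrAC; apply: ler_wpM2r; first by rewrite exprn_ge0 ?ltW.
  by move: zM; rewrite ler_pdivrMr //; lra.
by move: T hq2; lra.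
Qed.

(** The degree condition bounds [A / B], and [ys] has one element more than [zs], so the whole is of
    order [e^(- kappa t)] uniformly in [p]. *)
Lemma ratE_right_end (kappa : R) (A B : {poly R}) (zs ys : seq R) : 0 < kappa -> B != 0 -> (size A <= size B)%N ->
  (forall z, z \in zs -> 0 < z) -> (forall y, y \in ys -> 0 < y) ->
  size ys = (size zs).+1 -> forall e, 0 < e ->
  exists M, forall t p, M <= t -> normc (subst (at_pt kappa t p) (ratE A B zs ys)) < e.
Proof.
move=> k0 B0 sAB zs0 ys0 sz e e0.
have sB : size B = (size B).-1.+1 by rewrite prednK // lt0n size_poly_eq0.
have [MA MA0 hA] : exists2 M, 0 < M & forall z : C, 1 <= normc z ->
    normc A^:C.[z] <= M * normc z ^+ (size B).-1.
  by apply: poly_growth; rewrite -sB.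
have [MB [mB [MB1 mB0 hB]]] := poly_growth_lower B0.
(* [S] exceeds every [z] and every [2 y]; once [E = |W|] exceeds [S], each [|W + z|] is at most
   [2 E] and each [|W - y|] at least [E / 2]. *)
set S := \sum_(z <- zs) z + \sum_(y <- ys) (2 * y) + 1.
have sumpos (s : seq R) (f : R -> R) : (forall x, x \in s -> 0 <= f x) ->
    forall x, x \in s -> f x <= \sum_(x <- s) f x.
  move=> hs x xs; rewrite (big_rem x) //= lerDl big_seq sumr_ge0 // => y ys'.
  by apply: hs; exact: mem_rem ys'.
have sz0 : 0 <= \sum_(z <- zs) z.
  by rewrite big_seq sumr_ge0 // => z /zs0/ltW.
have sy0 : 0 <= \sum_(y <- ys) (2 * y).
  by rewrite big_seq sumr_ge0 // => y /ys0/ltW; rewrite pmulr_rge0.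
have S1 : 1 <= S by rewrite /S; lra.
set K := MA / mB * 2 ^+ (size zs + size ys).
have K0 : 0 < K by rewrite mulr_gt0 ?divr_gt0 ?exprn_gt0.
exists (Num.max (ln MB) ((Num.max S (K / e) + 1) / kappa)) => t p.
rewrite ge_max => /andP[tM]; rewrite ler_pdivrMr // (mulrC t) => kt.
have E1 : Num.max S (K / e) < expR (kappa * t).
  apply: (@lt_le_trans _ _ (Num.max S (K / e) + 1)); first by rewrite ltrDl.
  by apply: (le_trans kt); apply: (le_trans _ (expR_ge1Dx _)); rewrite lerDr.
move: E1; rewrite gt_max; set E := expR _ => /andP[ES EK].
have E0 : 0 < E by rewrite expR_gt0.
rewrite subst_ratE !ComplexField.Normc.normcM ComplexField.Normc.normcV.
have nw : normc (at_pt kappa t p false) = expR t by rewrite normc_cexp mul1r.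
have nW : normc (at_pt kappa t p true) = E by rewrite normc_cexp.
set w := at_pt kappa t p false in nw *; set W := at_pt kappa t p true in nW *.
have ew : MB <= expR t.
  by rewrite -[leLHS]lnK ?posrE ?(lt_le_trans _ MB1) // ler_expR.
have h1 : normc A^:C.[w] / normc B^:C.[w] <= MA / mB.
  have := hB w; rewrite nw => /(_ ew) h; have := hA w; rewrite nw => /(_ (le_trans MB1 ew)) h'.
  have x0 : 0 < expR t ^+ (size B).-1 by rewrite exprn_gt0 ?expR_gt0.
  have nB0 : 0 < normc B^:C.[w] by apply: lt_le_trans h; rewrite mulr_gt0.
  rewrite ler_pdivrMr //; apply: (le_trans h').
  have : MA / mB * (mB * expR t ^+ (size B).-1) <= MA / mB * normc B^:C.[w].
    by rewrite ler_pM2l // divr_gt0.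
  by rewrite mulrA divfK ?gt_eqF.
have prod_cst (s : seq R) (c : R) : \prod_(z <- s) c = c ^+ size s.
  by rewrite big_const_seq count_predT; elim: (size s) => //= n ->; rewrite exprS.
have h2 : normc (\prod_(z <- zs) (W + z%:C)) <= (2 * E) ^+ size zs.
  rewrite normc_prod -prod_cst big_seq [leRHS]big_seq; apply: ler_prod => z zin.
  rewrite normc_ge0 andTb; apply: (le_trans (le_normcD _ _)); rewrite nW normcC.
  have z0 := zs0 z zin; rewrite gtr0_norm //.
  have := sumpos zs id (fun x xs => ltW (zs0 x xs)) z zin; rewrite /= => zle.
  by move: ES; rewrite /S; lra.
have h3 : normc (\prod_(y <- ys) (W - y%:C)^-1) <= (2 / E) ^+ size ys.
  rewrite normc_prod -prod_cst big_seq [leRHS]big_seq; apply: ler_prod => y yin.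
  rewrite normc_ge0 ComplexField.Normc.normcV andTb.
  have y0 := ys0 y yin.
  have yle : 2 * y <= \sum_(y <- ys) 2 * y.
    apply: (sumpos ys (fun y => 2 * y)) yin => x xin.
    by rewrite mulr_ge0 // ltW // ys0.
  have hE2 : E / 2 <= normc (W - y%:C).
    have := le_normcD (W - y%:C) y%:C; rewrite subrK nW normcC gtr0_norm //.
    by move: ES; rewrite /S; lra.
  have -> : 2 / E = (E / 2)^-1 by rewrite invf_div.
  by rewrite lef_pV2 ?posrE ?(lt_le_trans _ hE2) ?divr_gt0.
have q0 : 0 <= normc A^:C.[w] / normc B^:C.[w].
  by rewrite divr_ge0 ?normc_ge0.
apply: (@le_lt_trans _ _ (K / E)).
  have -> : K / E = MA / mB * ((2 * E) ^+ size zs * (2 / E) ^+ size ys).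
    rewrite /K exprD sz !exprS !exprMn exprVn; field.
    by rewrite !gt_eqF ?exprn_gt0.
  apply: ler_pM => //; first by rewrite mulr_ge0 ?normc_ge0.
  by apply: ler_pM; rewrite ?normc_ge0.
by rewrite ltr_pdivrMr // mulrC -ltr_pdivrMr.
Qed.
End RationalExpressions.

(** * From the sign on the boundary to monotonicity on the real axis *)

Section SectorRolle.
Local Open Scope complex_scope.
Local Open Scope classical_set_scope.
Variables (R : realType).
Local Notation C := R[i].

Lemma nbhs_pair_box (P : R * R -> Prop) (t p : R) : (\forall q \near (t, p), P q) ->
  exists2 d, 0 < d & forall t' p', `|t' - t| < d -> `|p' - p| < d -> P (t', p').
Proof.
case=> -[A1 A2] [/= /nbhs_ballP[d1 /= d10 h1] /nbhs_ballP[d2 /= d20 h2]] hP.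
exists (Num.min d1 d2); first by rewrite lt_min d10.
move=> t' p'; rewrite !lt_min => /andP[a1 _] /andP[_ a2]; apply: hP; split => /=.
  by apply: h1; rewrite /ball /= distrC.
by apply: h2; rewrite /ball /= distrC.
Qed.

Lemma ccvgM (T : Type) (F : set_system T) {FF : Filter F} (f g : T -> C) (a b : C) :
  ccvg F f a -> ccvg F g b -> ccvg F (fun q => f q * g q) (a * b).
Proof.
move=> [? ?] [? ?]; split; rewrite ?(ReM, ImM).
  by under eq_fun do rewrite ReM; apply: (@cvgB _ R^o); exact: cvgM.
by under eq_fun do rewrite ImM; apply: (@cvgD _ R^o); exact: cvgM.
Qed.

Lemma ccvg_within (T : topologicalType) (A : set T) (q : T) (f : T -> C) (z : C) :
  ccvg (nbhs q) f z -> ccvg (within A (nbhs q)) f z.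
Proof. by move=> [? ?]; split; exact: cvg_within_filter. Qed.

(** Both exponentials increase with [t], so corresponding differences have the same sign. This
    transfers a sign pattern from [e^t] to [e^(kappa t)]. *)
Lemma prod_expR_sign (kappa t : R) (ps : seq R) : 0 < kappa ->
  exists2 c, 0 <= c & \prod_(x <- ps) (expR (kappa * t) - expR (kappa * x)) =
     c * \prod_(x <- ps) (expR t - expR x).
Proof.
move=> k0; elim: ps => [|x ps [c c0 hc]]; first by exists 1; rewrite ?big_nil ?mulr1.
have [d d0 hd] : exists2 d, 0 <= d &
    expR (kappa * t) - expR (kappa * x) = d * (expR t - expR x).
  have [->|tx] := eqVneq t x; first by exists 0; rewrite ?subrr ?mulr0.
  have ne : expR t - expR x != 0.
    by rewrite subr_eq0; apply: contra tx => /eqP/expR_inj ->.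
  exists ((expR (kappa * t) - expR (kappa * x)) / (expR t - expR x)); last by rewrite divfK.
  case: (ltgtP t x) tx => // [tx|xt] _.
    rewrite -mulrNN -invrN !opprB divr_ge0 // subr_ge0 ler_expR ?ler_pM2l // ltW //.
  by rewrite divr_ge0 // subr_ge0 ler_expR ?ler_pM2l // ltW.
by exists (d * c); rewrite ?mulr_ge0 // !big_cons hc hd; ring.
Qed.

(** The argument of [e^(kappa s)] is [kappa p], in [[0, pi]], so this number is a positive real only
    on the edge [p = 0], where the exponential is injective. *)
Lemma strip_power_neq (kappa tau t p : R) : 0 <= kappa * p <= pi -> 0 < kappa ->
  (t, p) != (tau, 0) -> cexp (kappa * t) (kappa * p) != (expR (kappa * tau))%:C.
Proof.
move=> /andP[p0 p1] k0; apply: contra; rewrite eq_complex /= => /andP[/eqP hr].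
rewrite mulf_eq0 gt_eqF ?expR_gt0 //= => /eqP hs.
have kp : kappa * p = 0.
  apply/eqP; rewrite eq_le p0 andbT leNgt; apply/negP => kp0.
  move: p1; rewrite le_eqVlt => /orP[/eqP kpi|kpi].
    move: hr; rewrite kpi cospi mulrN1 => hr.
    have := expR_gt0 (kappa * t); have := expR_gt0 (kappa * tau); lra.
  by have := sin_gt0_pi; move=> /(_ _ (kappa * p)); rewrite kp0 kpi => /(_ isT); rewrite hs ltxx.
move: hr; rewrite kp cos0 mulr1 => /expR_inj/(mulfI (lt0r_neq0 k0)) ->.
by move/eqP: kp; rewrite mulf_eq0 (gt_eqF k0) /= => /eqP ->.
Qed.

(** Under [w = e^s] the sector is the strip [0 <= p <= pi / kappa]. [ps] holds the logarithms of the
    sign changes, [ts] and [ts0] those of the zeros of [A], with [ts0] the largest. The bound on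
    [size A] gives decay at the right end, and [B.[0] != 0] a real limit at the left end. *)
Theorem sector_rolle (kappa : R) (A B : {poly R}) (ps ts : seq R) (ts0 : R) :
  0 < kappa -> A != 0 -> (size A <= size B)%N -> B.[0] != 0 ->
  (forall t p, 0 <= kappa * p <= pi -> B^:C.[cexp t p] != 0) ->
  uniq ts -> size ts = (size ps).+1 -> (forall tau, tau \in ts -> tau < ts0) ->
  (forall tau, tau \in ts -> A.[expR tau] = 0) -> A.[expR ts0] = 0 ->
  (forall t, Im (A^:C.[cexp t (pi / kappa)] / B^:C.[cexp t (pi / kappa)]) *
     \prod_(x <- ps) (expR t - expR x) <= 0) ->
  False.
Proof.
move=> k0 A0 sAB B00 hB uts sts ts_lt Ats Ats0 hsign.
have B0 : B != 0 by apply: contra B00 => /eqP ->; rewrite horner0.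
set th := pi / kappa.
have th0 : 0 < th by rewrite divr_gt0 ?pi_gt0.
have strip p : 0 <= p <= th -> 0 <= kappa * p <= pi.
  move=> /andP[p0 p1]; rewrite mulr_ge0 ?(ltW k0) //= mulrC -ler_pdivlMr //.
set zs := map (fun x => expR (kappa * x)) ps.
set ys := map (fun x => expR (kappa * x)) ts.
set e := ratE A B zs ys.
set G := fun t p => subst (at_pt kappa t p) e.
have wE t p : at_pt kappa t p false = cexp t p by rewrite /at_pt /= !mul1r.
have WE t p : at_pt kappa t p true = cexp (kappa * t) (kappa * p) by [].
have inv t p : 0 <= p <= th -> (p == 0 -> t \notin ts) -> invertible (at_pt kappa t p) e.
  move=> pth tp; apply: invertible_ratE; first by rewrite wE; apply: hB; exact: strip.
  move=> _ /mapP[tau tauts ->]; rewrite WE; apply: strip_power_neq => //.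
    exact: strip.
  rewrite xpair_eqE; apply/negP => /andP[/eqP ttau p0].
  by move: (tp p0); rewrite ttau tauts.
have cexp0 u : cexp u 0 = (expR u)%:C.
  by apply: complexP; rewrite /= ?cos0 ?sin0 ?mulr1 ?mulr0.
have h0 t : Im (G t 0) = 0.
  by apply: Im_ratE => b; rewrite /at_pt mulr0 cexp0.
(* On the upper edge [W] is a negative real, so the added product is real; since [ts] has one
   element more than [ps], the signs collected from both products amount to [-1], which reverses
   [hsign]. *)
have hth t : 0 <= Im (G t th).
  rewrite /G /e subst_ratE wE WE.
  have -> : kappa * th = pi by rewrite /th mulrC divfK // gt_eqF.
  have -> : cexp (kappa * t) pi = (- expR (kappa * t))%:C.
    by apply: complexP; rewrite /= ?cospi ?sinpi ?mulrN1 ?mulr0.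
  under eq_bigr do rewrite -rmorphD /=.
  under [X in _ * (_ * X)]eq_bigr do rewrite -rmorphB -fmorphV /=.
  rewrite -!rmorph_prod -!rmorphM ImM /= mulr0 add0r.
  rewrite /zs /ys !big_map.
  have [c c0 hc] := prod_expR_sign t ps k0.
  have -> : \prod_(x <- ps) (- expR (kappa * t) + expR (kappa * x)) =
     (- 1) ^+ size ps * (c * \prod_(x <- ps) (expR t - expR x)).
    rewrite -hc; elim: (ps) => [|x s IH]; first by rewrite !big_nil mulr1.
    by rewrite !big_cons IH /= exprS; ring.
  have [d d0 ->] : exists2 d, 0 <= d &
     \prod_(x <- ts) (- expR (kappa * t) - expR (kappa * x))^-1 = (-1) ^+ size ts * d.
    elim: (ts) => [|x s [d d0 IH]]; first by exists 1; rewrite ?big_nil ?mulr1.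
    exists ((expR (kappa * t) + expR (kappa * x))^-1 * d).
      by rewrite mulr_ge0 // invr_ge0 addr_ge0 ?expR_ge0.
    rewrite big_cons IH /= exprS -opprD invrN; ring.
  rewrite sts exprS mulN1r.
  have := hsign t; set I := Im _; set P := \prod_(x <- ps) _ => IP.
  have -> : I * ((-1) ^+ size ps * (c * P) * (- (-1) ^+ size ps * d)) =
    ((-1) ^+ size ps) ^+ 2 * (c * d) * (- (I * P)) by ring.
  by rewrite mulr_ge0 ?oppr_ge0 // mulr_ge0 ?sqr_ge0 // mulr_ge0.
(* At [(tau, 0)] with [tau] in [ts], the junk value [G = 0] is in general not the
   limit of [G], but that limit is real, so [Im G] is continuous there. *)
have hcont t p : 0 <= p <= th -> forall eps : R, 0 < eps -> exists2 d : R, 0 < d &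
     forall t' p', 0 <= p' <= th -> `|t' - t| < d -> `|p' - p| < d ->
       `|Im (G t' p') - Im (G t p)| < eps.
  move=> pth eps eps0.
  case: (boolP ((p == 0) && (t \in ts))) => [/andP[/eqP pE tts]|reg]; last first.
    have reg' : p == 0 -> t \notin ts by move=> pE; move: reg; rewrite pE.
    have [_] := ccvg_at_pt (inv t p pth reg').
    move=> /cvgrPdist_lt/(_ eps eps0)/nbhs_pair_box[d d0 hd].
    by exists d => // t' p' _ a1 a2; rewrite distrC; exact: hd.
  rewrite {p pth}pE.
  set y := expR t.
  (* The zero of [A] cancels the pole of the product at this point; the remaining expression [e1] is
     regular and real there. *)
  have [A1 AE] : exists A1, A = A1 * ('X - y%:P).
    by apply/factor_theorem/rootP; exact: Ats.
  set e1 := ratE A1 B zs (map (fun x => expR (kappa * x)) (rem t ts)).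
  have inv1 : invertible (at_pt kappa t 0) e1.
    apply: invertible_ratE; first by rewrite wE; apply: hB; rewrite mulr0 lexx pi_ge0.
    move=> _ /mapP[tau taurem ->]; rewrite WE; apply: strip_power_neq => //.
      by rewrite mulr0 lexx pi_ge0.
    rewrite xpair_eqE eqxx andbT; apply: contraL taurem => /eqP <-.
    by rewrite mem_rem_uniqF.
  have GE t' p' : G t' p' = (cexp t' p' - (expR t)%:C) /
      (cexp (kappa * t') (kappa * p') - (expR (kappa * t))%:C) *
      subst (at_pt kappa t' p') e1.
    rewrite /G /e /e1 !subst_ratE wE WE /ys !big_map [\prod_(j <- ts) _](big_rem t tts) /= AE.
    rewrite rmorphM /= rmorphB /= map_polyX map_polyC hornerM hornerXsubC; ring.
  have L := ccvgM (chi_cvg t k0) (@ccvg_within _ (fun q => q != (t, 0)) _ _ _ (ccvg_at_pt inv1)).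
  have Lim0 : Im ((expR t / (kappa * expR (kappa * t)))%:C * subst (at_pt kappa t 0) e1) = 0.
    rewrite ImM; have -> : Im (subst (at_pt kappa t 0) e1) = 0.
      by apply: Im_ratE => b; rewrite /at_pt mulr0 cexp0.
    by rewrite mulr0 mul0r addr0.
  case: L => _; rewrite Lim0 => /cvgrPdist_lt/(_ eps eps0).
  rewrite near_withinE => /nbhs_pair_box[d d0 hd].
  exists d => // t' p' _ a1 a2.
  case: (eqVneq (t', p') (t, 0)) => [[-> ->]|ne]; first by rewrite subrr normr0.
  rewrite h0 subr0 GE.
  by have := hd t' p' a1 a2 ne; rewrite sub0r normrN.
(* By Cauchy-Riemann, [Im G] has first derivatives [Im G'] and [Re G'], and second derivatives
   [Im G''] and [- Im G'']. *)
have hpos t p : 0 <= p <= th -> 0 <= Im (G t p).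
  apply: (@strip_min_principle R th (fun t p => Im (G t p))
    (fun t p => Im (subst (at_pt kappa t p) (sderiv kappa e)))
    (fun t p => Im (subst (at_pt kappa t p) (sderiv kappa (sderiv kappa e))))
    (fun t p => Re (subst (at_pt kappa t p) (sderiv kappa e)))
    (fun t p => - Im (subst (at_pt kappa t p) (sderiv kappa (sderiv kappa e))))) => //.
  - move=> {}t {}p /andP[p0 p1].
    have i0 : invertible (at_pt kappa t p) e.
      by apply: inv; rewrite ?(ltW p0) ?(ltW p1) // gt_eqF.
    have i1 := invertible_sderiv kappa i0.
    have [_ d1] := cder_at_pt_t i0.
    have [_ d2] := cder_at_pt_p i0.
    have [_ d3] := cder_at_pt_t i1.
    have [d4 _] := cder_at_pt_p i1.
    split => //; last by rewrite subrr.
      by move: d2; rewrite ImM /= mulr0 mulr1 addr0.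
    by move: d4; rewrite ReM /= mulr0 mulr1 sub0r.
  - by move=> s; rewrite h0.
  - move=> eps eps0.
    have [M hM] := @ratE_right_end R kappa A B zs ys k0 B0 sAB
      ltac:(by move=> _ /mapP[x _ ->]; exact: expR_gt0)
      ltac:(by move=> _ /mapP[x _ ->]; exact: expR_gt0)
      ltac:(by rewrite !size_map) eps eps0.
    have [_ /cvgrPdist_lt/(_ eps eps0)[N hN]] : ccvg (@near_left_end R)
        (fun q : R * R => subst (at_pt kappa q.1 q.2) e) (subst (fun=> 0) e).
      apply: ccvg_left_end => //; apply: invertible_ratE.
        by rewrite -(rmorph0 (real_complex R)) horner_map eq_complex /= negb_and B00.
      by move=> _ /mapP[x _ ->]; rewrite eq_complex /= negb_and eq_sym gt_eqF ?expR_gt0.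
    rewrite Im_ratE // in hN.
    exists (Num.max 0 (Num.max M (- N))) => s q _.
    rewrite !ge_max => /and3P[s0 sM sN].
    have [s_ge|s_lt] := leP 0 s.
      rewrite ger0_norm // in sM; have := hM s q sM => hlt.
      have := le_lt_trans (Im_le_normc _) hlt => /ltW.
      by rewrite ler_norml => /andP[].
    rewrite ltr0_norm // lerN2 in sN; have := hN s q sN.
    by rewrite /= sub0r normrN => /ltW; rewrite ler_norml => /andP[].
have ts0N : forall t, ts0 <= t -> t \notin ts.
  by move=> t tt; apply/negP => /ts_lt; rewrite ltNge tt.
have thge0 : 0 <= (0 : R) <= th by rewrite lexx ltW.
(* [Re G'] is the derivative of [Im G] in [p]; as [Im G] is [0] on the real edge and nonnegative
   above it, this derivative cannot be negative. *)
have dge t : ts0 <= t -> 0 <= Re (subst (at_pt kappa t 0) (sderiv kappa e)).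
  move=> tt; rewrite leNgt; apply/negP => dneg.
  have [_] := cder_at_pt_p (inv t 0 thge0 (fun _ => ts0N t tt)).
  rewrite ImM /= mulr0 mulr1 addr0 => /is_derive_near_lt/(_ dneg)[d d0 hd].
  set p := Num.min (d / 2) th.
  have p0 : 0 < p by rewrite lt_min th0 divr_gt0.
  have := hd p; rewrite p0 add0r gt_min ltr_pdivrMr // mulr2n mulrDr mulr1 ltrDl d0 /=.
  move=> /(_ isT); rewrite -/(G t 0) -/(G t p) h0 ltNge hpos // (ltW p0) /=.
  by rewrite ge_min lexx orbT.
have mono t1 t2 : ts0 <= t1 -> t1 <= t2 -> Re (G t1 0) <= Re (G t2 0).
  move=> a1 a2.
  have D t : ts0 <= t -> is_derive t 1 (fun t => Re (G t 0))
      (Re (subst (at_pt kappa t 0) (sderiv kappa e))).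
    by move=> tt; have [] := cder_at_pt_t (inv t 0 thge0 (fun _ => ts0N t tt)).
  have := a2; rewrite le_eqVlt => /orP[/eqP <- //|lt12].
  have [x||x /[!in_itv] /= /andP[x1 x2]] := @MVT R (fun t => Re (G t 0))
      (fun t => Re (subst (at_pt kappa t 0) (sderiv kappa e))) t1 t2 lt12.
  - by rewrite in_itv /= => /andP[x1 x2]; apply: D; rewrite (le_trans a1) // ltW.
  - apply: derivable_within_continuous => x; rewrite in_itv /= => /andP[x1 x2].
    by have [] := D x (le_trans a1 x1).
  - move=> E; rewrite -subr_ge0 E mulr_ge0 ?subr_ge0 // dge //.
    by rewrite (le_trans a1) // ltW.
have GR t : G t 0 = (Re (G t 0))%:C by apply: complexP; rewrite /= ?h0.
have Gts0 : Re (G ts0 0) = 0.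
  rewrite /G /e subst_ratE wE cexp0 !horner_map /= Ats0 rmorph0 !mul0r //.
(* Nondecreasing from the value [0] at [ts0] and tending to [0] at the right end, [G] vanishes on
   the whole half-line. Then so does [A], which would have too many roots. *)
have G0 t : ts0 <= t -> G t 0 = 0.
  move=> tt; rewrite GR; congr (_%:C); apply/eqP; rewrite eq_le; apply/andP; split; last first.
    by have := mono ts0 t (lexx _) tt; rewrite Gts0.
  rewrite leNgt; apply/negP => gt0.
  have [M hM] := @ratE_right_end R kappa A B zs ys k0 B0 sAB
      ltac:(by move=> _ /mapP[x _ ->]; exact: expR_gt0)
      ltac:(by move=> _ /mapP[x _ ->]; exact: expR_gt0)
      ltac:(by rewrite !size_map) _ gt0.
  set t' := Num.max t M.
  have := hM t' 0; rewrite le_max lexx orbT => /(_ isT).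
  move=> /(le_lt_trans (Re_le_normc _)); rewrite ltNge; apply/negP/negPn.
  apply: (le_trans _ (ler_norm _)); apply: (@mono t t') => //.
  by rewrite le_max lexx.
have Aroot t : ts0 <= t -> A.[expR t] = 0.
  move=> tt; have := G0 t tt; rewrite /G /e subst_ratE wE WE mulr0 !cexp0 => /eqP.
  have vi : invertible (at_pt kappa t 0) e := inv t 0 thge0 (fun _ => ts0N t tt).
  rewrite !mulf_eq0 !invr_eq0; case/orP; [case/orP|case/orP].
  - by rewrite horner_map eq_complex /= eqxx andbT => /eqP.
  - by rewrite -cexp0; move: (hB t 0); rewrite mulr0 lexx pi_ge0 => /(_ isT) /negbTE ->.
  - rewrite /zs big_map prodf_seq_eq0 => /hasP[x _ /=].
    by rewrite eq_complex /= gt_eqF ?addr_gt0 ?expR_gt0.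
  - rewrite /ys big_map prodf_seq_eq0 => /hasP[x xts /=].
    rewrite invr_eq0 subr_eq0 eq_complex /= eqxx andbT => /eqP/expR_inj/(mulfI (lt0r_neq0 k0)) tx.
    by move: (ts0N t tt); rewrite tx xts.
have /negP := A0; apply; apply/eqP.
pose rs := [seq expR (ts0 + i%:R) | i <- iota 0 (size A)].
apply: (@roots_geq_poly_eq0 _ A rs).
- apply/allP => _ /mapP[i _ ->]; apply/rootP; apply: Aroot.
  by rewrite lerDl.
- rewrite map_inj_uniq ?iota_uniq // => i j /expR_inj/addrI/eqP.
  by rewrite eqr_nat => /eqP.
- by rewrite size_map size_iota.
Qed.
End SectorRolle.

(** * Zeros of combinations of kernels *)

Section PartialFractions.
Local Open Scope complex_scope.
Variables (F : fieldType) (I : eqType) (B : I -> {poly F}).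
Implicit Types (c : I -> F) (xs : seq I).

(** Denominator and numerator of [sum c x / B x] over the unreduced common denominator: as
    polynomials they can be mapped to [C], composed, and bounded in degree. *)
Fixpoint pf_den xs : {poly F} := if xs is x :: xs then B x * pf_den xs else 1.
Fixpoint pf_num c xs : {poly F} :=
  if xs is x :: xs then c x *: pf_den xs + B x * pf_num c xs else 0.

Lemma pf_den_neq0 xs y : (forall x, x \in xs -> (B x).[y] != 0) -> (pf_den xs).[y] != 0.
Proof.
elim: xs => [|x xs IH] h /=; first by rewrite hornerC oner_eq0.
rewrite hornerM mulf_neq0 ?IH ?h ?mem_head // => z zxs.
by apply: h; rewrite inE zxs orbT.
Qed.

Lemma pf_den_eq0 xs x y : x \in xs -> (B x).[y] = 0 -> (pf_den xs).[y] = 0.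
Proof.
elim: xs => //= z xs IH; rewrite inE hornerM => /orP[/eqP <- ->|/IH h /h ->];
  by rewrite ?mul0r ?mulr0.
Qed.

Lemma pf_eval c xs y : (forall x, x \in xs -> (B x).[y] != 0) ->
  (pf_num c xs).[y] / (pf_den xs).[y] = \sum_(x <- xs) c x / (B x).[y].
Proof.
elim: xs => [|x xs IH] h /=; first by rewrite horner0 mul0r big_nil.
have h' z : z \in xs -> (B z).[y] != 0 by move=> zxs; apply: h; rewrite inE zxs orbT.
rewrite big_cons -IH // hornerD hornerZ !hornerM.
field; rewrite pf_den_neq0 // h // mem_head //.
Qed.

(** At a zero of [B x] every summand of the numerator but that of [x] contains the factor [B x], and
    the surviving one is a product of nonzero values. *)
Lemma pf_num_pole c xs x y : uniq xs -> x \in xs -> c x != 0 ->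
  (B x).[y] = 0 -> (forall z, z \in xs -> z != x -> (B z).[y] != 0) -> (pf_num c xs).[y] != 0.
Proof.
move=> + + cx Bx; elim: xs => //= z xs IH /andP[zxs uxs] + h.
rewrite inE hornerD hornerZ hornerM => /predU1P[xz|xxs].
  rewrite -xz Bx mul0r addr0 mulf_neq0 // pf_den_neq0 // => u uxs'.
  apply: h; rewrite ?inE ?uxs' ?orbT // xz.
  by apply: contraNneq zxs => <-.
rewrite (pf_den_eq0 xxs) // mulr0 add0r mulf_neq0 //.
  by apply: h; rewrite ?mem_head //; apply: contraNneq zxs => ->.
by apply: IH => // u uxs' ux; apply: h; rewrite // inE uxs' orbT.
Qed.

Lemma size_pf_den d xs : (forall x, B x \is monic) -> (forall x, size (B x) = d.+1) ->
  pf_den xs \is monic /\ size (pf_den xs) = (d * size xs).+1.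
Proof.
move=> mB sB; elim: xs => [|x xs [m s]] /=; first by rewrite monic1 size_poly1 muln0.
by rewrite monicMl // size_monicM ?monic_neq0 // sB s mulnS addSn addnS.
Qed.

(** The bound is the size of the denominator over [xs] alone, which is the degree condition of
    [sector_rolle] after division by the term of [x]. *)
Lemma size_pf_num d c x xs : (forall x, B x \is monic) -> (forall x, size (B x) = d.+1) ->
  (size (pf_num c (x :: xs)) <= (d * size xs).+1)%N.
Proof.
move=> mB sB; elim: xs x => [|z xs IH] x.
  by rewrite /= mulr0 addr0 alg_polyC size_polyC; case: (_ != 0).
have [m s] := size_pf_den (z :: xs) mB sB.
rewrite [pf_num _ _]/(_ + _); apply: (leq_trans (size_polyD _ _)).
rewrite geq_max; apply/andP; split.
  by apply: (leq_trans (size_scale_leq _ _)); rewrite s.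
apply: (leq_trans (size_polyMleq _ _)); rewrite sB addSn /=.
by apply: (leq_trans (leq_add (leqnn _) (IH z))); rewrite /= mulnS addnS.
Qed.

Lemma pf_num_eq0 c xs : (forall x, x \in xs -> c x = 0) -> pf_num c xs = 0.
Proof.
elim: xs => //= x xs IH h; rewrite h ?mem_head // scale0r add0r IH ?mulr0 // => z zxs.
by apply: h; rewrite inE zxs orbT.
Qed.

End PartialFractions.

Lemma pf_den_map (F : fieldType) (F' : fieldType) (f : {rmorphism F -> F'}) (I : eqType)
    (B : I -> {poly F}) xs : map_poly f (pf_den B xs) = pf_den (fun x => map_poly f (B x)) xs.
Proof. by elim: xs => [|x xs IH] /=; rewrite ?rmorph1 // rmorphM /= IH. Qed.

Lemma pf_num_map (F : fieldType) (F' : fieldType) (f : {rmorphism F -> F'}) (I : eqType)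
    (B : I -> {poly F}) c xs :
  map_poly f (pf_num B c xs) = pf_num (fun x => map_poly f (B x)) (fun x => f (c x)) xs.
Proof.
elim: xs => [|x xs IH] /=; rewrite ?rmorph0 // rmorphD rmorphM /= IH map_polyZ.
by rewrite pf_den_map.
Qed.

Lemma pf_den_comp (F : fieldType) (I : eqType) (B : I -> {poly F}) (p : {poly F}) xs :
  pf_den B xs \Po p = pf_den (fun x => B x \Po p) xs.
Proof. by elim: xs => [|x xs IH] /=; rewrite ?comp_polyC // comp_polyM IH. Qed.

Lemma pf_num_comp (F : fieldType) (I : eqType) (B : I -> {poly F}) (p : {poly F}) c xs :
  pf_num B c xs \Po p = pf_num (fun x => B x \Po p) c xs.
Proof.
elim: xs => [|x xs IH] /=; rewrite ?comp_poly0 // comp_polyD comp_polyZ comp_polyM IH.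
by rewrite pf_den_comp.
Qed.

(** * The polynomials [qpow] and their values on a rotated ray *)

Section QPower.
Local Open Scope complex_scope.
Variables (R : realType) (theta : R).
Local Notation C := R[i].

(** The product of [X + e^(i j theta) x] and its conjugate [X + e^(- i j theta) x], in real form. *)
Definition qfactor (j : nat) (x : R) : {poly R} :=
  'X^2 + (2 * cos (j%:R * theta) * x) *: 'X + (x ^+ 2)%:P.

(* [prod_(l < r) ('X + e^(i (r - 1 - 2 l) theta) x)], with conjugate factors paired *)
Fixpoint qpow (x : R) (r : nat) : {poly R} :=
  match r with
  | 0 => 1
  | 1 => 'X + x%:P
  | (r'.+1 as r1).+1 => qpow x r' * qfactor r1 x
  end.

Lemma qpow_ind (P : nat -> Prop) : P 0%N -> P 1%N -> (forall r, P r -> P r.+2) -> forall r, P r.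
Proof.
move=> h0 h1 h2 r; suff [] : P r /\ P r.+1 by [].
by elim: r => // r [h h']; split => //; apply: h2.
Qed.

Lemma qpowSS x r : qpow x r.+2 = qpow x r * qfactor r.+1 x.
Proof. by []. Qed.

Lemma qfactor_monic j x : qfactor j x \is monic /\ size (qfactor j x) = 3%N.
Proof.
have s : (size ((2 * cos (j%:R * theta) * x) *: 'X + (x ^+ 2)%:P)%R < size ('X^2 : {poly R}))%N.
  rewrite size_polyXn; apply: (leq_ltn_trans (size_polyD _ _)).
  rewrite gtn_max; apply/andP; split.
    by apply: (leq_ltn_trans (size_scale_leq _ _)); rewrite size_polyX.
  by apply: (leq_ltn_trans (size_polyC_leq1 _)).
rewrite /qfactor -addrA; split; last by rewrite size_polyDl // size_polyXn.
by rewrite monicE lead_coefDl // lead_coefXn.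
Qed.

Lemma qpow_monic x r : qpow x r \is monic /\ size (qpow x r) = r.+1.
Proof.
elim/qpow_ind: r => [||r [m s]].
- by rewrite monic1 size_poly1.
- by rewrite /= -[x]opprK polyCN monicXsubC size_XsubC.
have [m' s'] := qfactor_monic r.+1 x.
by rewrite qpowSS monicMl // size_monicM ?monic_neq0 // s s' addnC.
Qed.

Lemma horner_qfactor j x y :
  (qfactor j x).[y] = y ^+ 2 + 2 * cos (j%:R * theta) * x * y + x ^+ 2.
Proof. by rewrite !hornerE. Qed.

Lemma horner_qfactorC j x w : (qfactor j x)^:C.[w] =
  (w + cexp 0 (j%:R * theta) * x%:C) * (w + cexp 0 (- (j%:R * theta)) * x%:C).
Proof.
have qq : cexp 0 (j%:R * theta) * cexp 0 (- (j%:R * theta)) = 1.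
  by rewrite -cexpD addr0 subrr; apply: complexP; rewrite /= ?cos0 ?sin0 expR0 ?mulr1 ?mulr0.
have qD : cexp 0 (j%:R * theta) + cexp 0 (- (j%:R * theta)) = (2 * cos (j%:R * theta))%:C.
  by apply: complexP; rewrite ?(ReD, ImD) /= expR0 ?cosN ?sinN; ring.
rewrite !rmorphD /= map_polyZ /= map_polyXn map_polyX map_polyC !hornerE /=.
rewrite [X in _ + X](_ : _ = x%:C ^+ 2); last by rewrite -rmorphXn.
rewrite (_ : (2 * cos (j%:R * theta) * x)%:C = (cexp 0 (j%:R * theta) +
  cexp 0 (- (j%:R * theta))) * x%:C); last by rewrite qD -rmorphM.
transitivity (w ^+ 2 + (cexp 0 (j%:R * theta) + cexp 0 (- (j%:R * theta))) * x%:C * w +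
  (cexp 0 (j%:R * theta) * cexp 0 (- (j%:R * theta))) * x%:C ^+ 2); last by ring.
by rewrite qq; ring.
Qed.

Lemma cexp_add_neq0 (t b x : R) : - pi < b < pi -> 0 < x -> cexp t b + x%:C != 0.
Proof.
move=> /andP[b1 b2] x0; rewrite eq_complex /= addr0 negb_and -negb_and.
apply/negP => /andP[/eqP hr]; rewrite mulf_eq0 gt_eqF ?expR_gt0 //= => /eqP hs.
suff b0 : b = 0 by move: hr; rewrite b0 cos0 mulr1; have := expR_gt0 t; lra.
case: (ltgtP b 0) => // [bneg|bpos].
  have := @sin_gt0_pi R (- b); rewrite oppr_gt0 bneg sinN hs oppr0 ltxx.
  by move=> h; exfalso; apply: notF; apply: h; rewrite ltrNl.
by have := @sin_gt0_pi R b; rewrite bpos b2 hs ltxx => /(_ isT).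
Qed.

(** Each factor [w + e^(i a) x] is [e^(i a) (e^(- i a) w + x)], and for [a = j theta] or
    [a = - j theta] the rotated argument stays strictly between [- pi] and [pi]. *)
Lemma qfactorC_neq0 j x t p : 0 < x -> 0 <= p -> 0 <= theta -> p + j%:R * theta < pi ->
  (qfactor j x)^:C.[cexp t p] != 0.
Proof.
move=> x0 p0 th0 hp; have j0 : 0 <= j%:R * theta by rewrite mulr_ge0.
have rot a : cexp t p + cexp 0 a * x%:C = cexp 0 a * (cexp t (p - a) + x%:C).
  by rewrite mulrDr -cexpD add0r [a + _]addrC subrK.
have q0 a : cexp 0 a != 0 :> C.
  apply/eqP => /(congr1 (@normc R)); rewrite normc_cexp expR0 ComplexField.Normc.normc0.
  by move/eqP; rewrite oner_eq0.
rewrite horner_qfactorC !rot !mulf_neq0 // cexp_add_neq0 //; apply/andP; split; lra.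
Qed.

Lemma qpowC_neq0 x r t p : 0 < x -> 0 <= p < pi -> 0 <= theta ->
  p + r.-1%:R * theta < pi -> (qpow x r)^:C.[cexp t p] != 0.
Proof.
move=> x0 /andP[p0 ppi] th0; elim/qpow_ind: r => [_||r IH hr].
- by rewrite rmorph1 hornerC oner_eq0.
- move=> _; rewrite rmorphD /= map_polyX map_polyC hornerD hornerX hornerC.
  apply: cexp_add_neq0 => //; rewrite ppi andbT.
  by apply: lt_le_trans p0; rewrite oppr_lt0 pi_gt0.
rewrite qpowSS rmorphM hornerM mulf_neq0 ?qfactorC_neq0 // IH //.
apply: le_lt_trans hr; rewrite lerD2l ler_wpM2r // ler_nat.
by case: (r) => //= n; rewrite (leq_trans (leqnSn _)).
Qed.

Lemma qfactor_gt0 j x y : 0 < x -> 0 < y -> 0 <= theta -> j%:R * theta < pi ->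
  0 < (qfactor j x).[y].
Proof.
move=> x0 y0 th0 hj; rewrite horner_qfactor.
have c1 : -1 < cos (j%:R * theta).
  rewrite -cospi ltr_cos ?in_itv /= ?pi_ge0 ?lexx //.
  by rewrite mulr_ge0 //= ltW.
have xy : 0 < x * y by rewrite mulr_gt0.
have -> : y ^+ 2 + 2 * cos (j%:R * theta) * x * y + x ^+ 2 =
  (y - x) ^+ 2 + 2 * ((cos (j%:R * theta) + 1) * (x * y)) by ring.
rewrite ltr_wpDl ?sqr_ge0 // mulr_gt0 // mulr_gt0 //; lra.
Qed.

Lemma qpow_gt0 x r y : 0 < x -> 0 < y -> 0 <= theta -> r.-1%:R * theta < pi ->
  0 < (qpow x r).[y].
Proof.
move=> x0 y0 th0; elim/qpow_ind: r => [_||r IH hr].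
- by rewrite hornerC ltr01.
- by move=> _; rewrite !hornerE addr_gt0.
rewrite qpowSS hornerM mulr_gt0 ?qfactor_gt0 // IH //.
apply: le_lt_trans hr; rewrite ler_wpM2r // ler_nat.
by case: (r) => //= n; rewrite (leq_trans (leqnSn _)).
Qed.

(** With [q = e^(i theta)] and [w = q y], the factor [w + q^(r - 2 l) x] of rank [r + 1] is
    [q (y + q^(r - 1 - 2 l) x)]. For [l < r] these are the factors of rank [r]; the one left over,
    [l = r], becomes [q^(r + 1) y + x] once it absorbs the phases. *)
Lemma qpow_rotate x r t : (qpow x r.+1)^:C.[cexp t theta] =
  (cexp t (r.+1%:R * theta) + x%:C) * ((qpow x r).[expR t])%:C.
Proof.
elim/qpow_ind: r => [||r IH].
- rewrite [1%:R * _]mul1r rmorphD /= map_polyX map_polyC /= !hornerE.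
  by [].
- have -> : (qpow x 2)^:C.[cexp t theta] = (cexp t theta + cexp 0 theta * x%:C) *
      (cexp t theta + cexp 0 (- theta) * x%:C).
    by rewrite /= mul1r horner_qfactorC mul1r.
  rewrite [(qpow x 1).[_]](_ : _ = expR t + x); last by rewrite !hornerE.
  have -> : cexp t theta = cexp 0 theta * cexp t 0 by rewrite -cexpD add0r addr0.
  have -> : cexp t (2 * theta) = cexp 0 theta * cexp 0 theta * cexp t 0.
    by rewrite -!cexpD !add0r addr0 mulr_natl mulr2n.
  have -> : (expR t + x)%:C = cexp t 0 + x%:C.
    by apply: complexP; rewrite ?(ReD, ImD) /= ?cos0 ?sin0; ring.
  have q1 : cexp 0 theta * cexp 0 (- theta) = 1.
    by rewrite -cexpD addr0 subrr; apply: complexP; rewrite /= ?cos0 ?sin0 expR0 ?mulr1 ?mulr0.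
  transitivity ((cexp t 0 + x%:C) * (cexp 0 theta * cexp 0 theta * cexp t 0
    + cexp 0 theta * cexp 0 (- theta) * x%:C)); first by ring.
  by rewrite q1 mul1r mulrC.
rewrite !qpowSS rmorphM hornerM IH hornerM horner_qfactorC.
set q := cexp 0 theta; set Q := cexp 0 (r.+1%:R * theta).
set Q' := cexp 0 (- (r.+1%:R * theta)); set q' := cexp 0 (- theta); set y := cexp t 0.
have c00 : cexp 0 0 = 1 :> C.
  by apply: complexP; rewrite /= ?cos0 ?sin0 expR0 ?mulr1 ?mulr0.
have q1 : q * q' = 1 by rewrite -cexpD addr0 subrr c00.
have Q1 : Q * Q' = 1 by rewrite -cexpD addr0 subrr c00.
have e1 : cexp t theta = q * y by rewrite -cexpD add0r addr0.
have e2 : cexp t (r.+1%:R * theta) = Q * y by rewrite -cexpD add0r addr0.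
have e3 : cexp 0 (r.+2%:R * theta) = Q * q.
  by rewrite -cexpD add0r -[r.+2%:R]natr1 mulrDl mul1r.
have e4 : cexp 0 (- (r.+2%:R * theta)) = Q' * q'.
  by rewrite -cexpD add0r -[r.+2%:R]natr1 mulrDl mul1r opprD.
have e5 : cexp t (r.+3%:R * theta) = Q * q * q * y.
  rewrite -!cexpD !add0r addr0 -[r.+3%:R]natr1 -[r.+2%:R]natr1 !mulrDl !mul1r.
  by congr cexp.
have e6 : (expR t)%:C = y.
  by apply: complexP; rewrite /= ?cos0 ?sin0 ?mulr1 ?mulr0.
have e7 : ((qfactor r.+1 x).[expR t])%:C = (y + Q * x%:C) * (y + Q' * x%:C).
  by rewrite -horner_map /= horner_qfactorC e6.
rewrite rmorphM /= e7 e1 e2 e3 e4 e5.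
set b := (_).[_]%:C.
transitivity ((Q * y + (Q * Q') * x%:C) * b * ((q * y + Q * q * x%:C) *
   (q * y + Q' * q' * x%:C))); first by rewrite Q1 mul1r.
transitivity ((Q * q * q * y + (Q * Q') * (q * q') * x%:C) * (b * ((y + Q * x%:C) * (y + Q' * x%:C)))).
  by ring.
by rewrite Q1 q1 !mul1r.
Qed.

Lemma Im_mul_real (z : C) (k : R) : Im (z * k%:C) = Im z * k.
Proof. by rewrite ImM /= mulr0 add0r. Qed.

(** For [Z = cexp t a], the product of [Z + x0] with the conjugate of [Z + x] has imaginary part
    [Im Z (x - x0)]; the denominator is [|Z + x|^2]. *)
Lemma Im_rotate_quotient (t a x x0 : R) : - pi < a < pi -> 0 < x ->
  Im ((cexp t a + x0%:C) / (cexp t a + x%:C)) =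
  sin a * expR t * (x - x0) / (expR t ^+ 2 + 2 * cos a * x * expR t + x ^+ 2).
Proof.
move=> ha x_gt0; have := sqnorm_neq0 (cexp_add_neq0 t ha x_gt0).
rewrite ImM !(ReV, ImV) !(ReD, ImD) /= !addr0.
have := cos2Dsin2 a; set c := cos a; set s := sin a => cs.
have E : (expR t * c + x) ^+ 2 + (expR t * s) ^+ 2 =
   expR t ^+ 2 + 2 * c * x * expR t + x ^+ 2.
  rewrite !exprMn (_ : s ^+ 2 = 1 - c ^+ 2); last by rewrite -cs addrAC subrr add0r.
  ring.
rewrite E => n0; field; exact: n0.
Qed.

(* The real-line partial fractions reappear, with [r] replaced by [r + 1], as
   the imaginary part on the ray [arg w = theta]. *)
Lemma Im_qpow_quotient (t : R) r (x x0 : R) : 0 < x -> 0 < x0 -> 0 <= theta -> r.+1%:R * theta < pi ->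
  Im ((qpow x0 r.+1)^:C.[cexp t theta] / (qpow x r.+1)^:C.[cexp t theta]) =
  sin (r.+1%:R * theta) * expR t * (qpow x0 r).[expR t] *
   ((x - x0) / (qpow x r.+2).[expR t]).
Proof.
move=> x_gt0 x0_gt0 th0 hr.
have hrr : r.-1%:R * theta < pi.
  apply: le_lt_trans hr; rewrite ler_wpM2r // ler_nat.
  by case: (r) => //= n; rewrite (leq_trans (leqnSn _)) // leqnSn.
have b0 : (qpow x r).[expR t] != 0 by rewrite gt_eqF // qpow_gt0 ?expR_gt0.
have b1 : (qpow x r.+2).[expR t] != 0 by rewrite gt_eqF // qpow_gt0 ?expR_gt0.
have ha : - pi < r.+1%:R * theta < pi.
  rewrite hr andbT; apply: (@lt_le_trans _ _ 0); first by rewrite oppr_lt0 pi_gt0.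
  by rewrite mulr_ge0.
rewrite !qpow_rotate.
have -> : (cexp t (r.+1%:R * theta) + x0%:C) * ((qpow x0 r).[expR t])%:C /
   ((cexp t (r.+1%:R * theta) + x%:C) * ((qpow x r).[expR t])%:C) =
   (cexp t (r.+1%:R * theta) + x0%:C) / (cexp t (r.+1%:R * theta) + x%:C) *
   ((qpow x0 r).[expR t] / (qpow x r).[expR t])%:C.
  rewrite rmorphM fmorphV; field.
  by rewrite eq_complex /= negb_and b0 /= cexp_add_neq0.
rewrite Im_mul_real Im_rotate_quotient //.
move: b1; rewrite qpowSS hornerM horner_qfactor => b1.
have b2 : expR t ^+ 2 + 2 * cos (r.+1%:R * theta) * x * expR t + x ^+ 2 != 0.
  by apply: contraNneq b1 => ->; rewrite mulr0.
by field; rewrite b0 b2.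
Qed.
End QPower.

(** * Sign patterns of polynomials, and the full rank [r theta = pi] *)

Section ZeroCount.
Local Open Scope complex_scope.
Variables (R : realType).
Implicit Types (p : {poly R}) (c : R -> R) (xs ys : seq R).

Lemma poly_positive_sign p : p != 0 -> (forall y, 0 < y -> p.[y] != 0) ->
  (forall y, 0 < y -> 0 <= p.[y]) \/ (forall y, 0 < y -> p.[y] <= 0).
Proof.
move=> p0 hp.
have key (q : {poly R}) : (forall y, 0 < y -> q.[y] != 0) -> 0 < q.[1] ->
    forall y, 0 < y -> 0 <= q.[y].
  move=> hq q1 y y0; rewrite leNgt; apply/negP => qy.
  have [y1|/ltW y1] := leP y 1.
    have [|z /andP[yz _]] := @poly_ivt _ q y 1 y1.
      by rewrite !ltW.
    by move/rootP/eqP; rewrite (negbTE (hq z (lt_le_trans y0 yz))).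
  have [|z /andP[yz _]] := @poly_ivt _ (- q) 1 y y1.
    by rewrite !hornerN oppr_le0 oppr_ge0 !ltW.
  by rewrite rootN => /rootP/eqP; rewrite (negbTE (hq z (lt_le_trans ltr01 yz))).
have := hp 1 ltr01; rewrite neq_lt => /orP[h|h]; [right|left]; last exact: key.
move=> y y0; rewrite -oppr_ge0 -hornerN; apply: key => //.
  by move=> z z0; rewrite hornerN oppr_eq0 hp.
by rewrite hornerN oppr_gt0.
Qed.

(** [P] consists of the positive zeros of odd multiplicity: dividing out one factor [X - z] toggles
    the membership of [z]. *)
Lemma poly_sign_pattern p : p != 0 -> exists P : seq R,
  [/\ uniq P, forall z, z \in P -> 0 < z /\ p.[z] = 0 &
      (forall y, 0 < y -> 0 <= p.[y] * \prod_(z <- P) (y - z)) \/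
      (forall y, 0 < y -> p.[y] * \prod_(z <- P) (y - z) <= 0)].
Proof.
have [n] := ubnP (size p); elim: n p => // n IH p sp p0.
case: (pselect (exists2 z, 0 < z & p.[z] = 0)) => [[z z0 pz]|hn]; last first.
  exists [::]; split => //; rewrite ?big_nil.
  case: (poly_positive_sign p0) => [y y0|h|h]; [|left|right];
    try by move=> y y0; rewrite big_nil mulr1 h.
  by apply/negP => /eqP py; apply: hn; exists y.
have [q pE] : exists q, p = q * ('X - z%:P) by apply/factor_theorem/rootP.
have q0 : q != 0 by apply: contraNneq p0 => q0; rewrite pE q0 mul0r.
have sq : (size q < n)%N.
  by move: sp; rewrite pE size_Mmonic ?monicXsubC // size_XsubC addn2 /= ltnS.
have [P [uP hP sP]] := IH q sq q0.
have root_q u : q.[u] = 0 -> p.[u] = 0 by move=> qu; rewrite pE hornerM qu mul0r.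
case: (boolP (z \in P)) => zP.
  exists (rem z P); split; first exact: rem_uniq.
    by move=> u /mem_rem/hP[? /root_q].
  have E y : p.[y] * \prod_(u <- rem z P) (y - u) = q.[y] * \prod_(u <- P) (y - u).
    by rewrite pE hornerM hornerXsubC (big_rem z zP) /= mulrA.
  by case: sP => h; [left|right] => y y0; rewrite E h.
exists (z :: P); split; first by rewrite /= zP.
  by move=> u; rewrite inE => /predU1P[->|/hP[? /root_q]].
have E y : p.[y] * \prod_(u <- z :: P) (y - u) =
   (y - z) ^+ 2 * (q.[y] * \prod_(u <- P) (y - u)).
  by rewrite pE hornerM hornerXsubC big_cons; ring.
case: sP => h; [left|right] => y y0; rewrite E.
  by rewrite mulr_ge0 ?sqr_ge0 ?h.
by rewrite mulr_ge0_le0 ?sqr_ge0 ?h.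
Qed.

Lemma qpow_at0 (theta x : R) r : (qpow theta x r).[0] = x ^+ r.
Proof.
elim/qpow_ind: r => [||r IH].
- by rewrite hornerC.
- by rewrite /= !hornerE.
by rewrite qpowSS hornerM IH horner_qfactor mulr0 expr0n /= !add0r -exprD addn2.
Qed.

(* At [r theta = pi] the rotation formula makes [qpow] real on a ray, which kills
   its inner coefficients. *)
Lemma qpow_full (theta : R) k (x : R) : 0 < theta -> k.+1%:R * theta = pi ->
  qpow theta x k.+1 = 'X^(k.+1) + (x ^+ k.+1)%:P.
Proof.
move=> th0 hk; set P := qpow theta x k.+1.
have [mP sP] := qpow_monic theta x k.+1.
(* At [expR t] this polynomial takes the value [Im P(cexp t theta)], which is [0] for all [t]. As
   [sin (l theta) > 0] for [0 < l < k.+1], the inner coefficients of [P] vanish. *)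
pose S := \poly_(l < k.+2) (P`_l * sin (l%:R * theta)).
have S0 : S = 0.
  pose rs := [seq expR (i%:R : R) | i <- iota 0 k.+2].
  apply: (@roots_geq_poly_eq0 _ S rs).
  - apply/allP => _ /mapP[i _ ->]; apply/rootP; set t : R := i%:R.
    have : Im (P^:C.[cexp t theta]) = 0.
      rewrite qpow_rotate hk Im_mul_real ImD /= sinpi mulr0 addr0 mul0r //.
    rewrite (horner_coef_wide _ (n := k.+2)); last by rewrite size_map_poly sP.
    rewrite horner_poly => h; rewrite -[RHS]h.
    have cX l : cexp t theta ^+ l = cexp (l%:R * t) (l%:R * theta).
      elim: l => [|l IHl].
        by rewrite !mul0r expr0; apply: complexP; rewrite /= expR0 ?cos0 ?sin0 ?mulr1 ?mulr0.
      by rewrite exprS IHl -cexpD -natr1 !mulrDl !mul1r ![_ + _ * _]addrC.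
    transitivity (\sum_(l < k.+2) Im ((P^:C)`_l * cexp t theta ^+ l)).
      apply: eq_bigr => l _; rewrite coef_map cX [_ * cexp _ _]mulrC Im_mul_real /=.
      by rewrite expRM_natl; ring.
    by elim/big_ind2: _ => // [u v w z -> ->]; rewrite ImD.
  - rewrite map_inj_uniq ?iota_uniq // => i j /expR_inj/eqP.
    by rewrite eqr_nat => /eqP.
  - by rewrite size_map size_iota size_poly.
apply/polyP => l; rewrite !coefE.
have [l_big|l_small] := ltnP k.+1 l.
  by rewrite nth_default ?sP // gtn_eqF // (gtn_eqF (leq_trans _ l_big)) // addr0.
have := congr1 (fun q : {poly R} => q`_l) S0; rewrite coef_poly coef0 ltnS l_small.
move: l_small; rewrite leq_eqVlt => /predU1P[-> _|l_lt].
  by rewrite eqxx /= addr0 -{1}[k.+1]/(k.+2.-1) -sP -lead_coefE (monicP mP).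
rewrite (ltn_eqF l_lt) add0r.
case: l l_lt => [_ _|l l_lt /eqP]; first by rewrite -horner_coef0 qpow_at0.
rewrite mulf_eq0 => /orP[/eqP //|/eqP hs]; exfalso.
have := @sin_gt0_pi R (l.+1%:R * theta); rewrite hs ltxx => h; suff : false by [].
by apply: h; rewrite mulr_gt0 //= -hk ltr_pM2r // ltr_nat.
Qed.
End ZeroCount.

Local Arguments qpow : simpl never.

(** * The induction step from rank [r + 1] to rank [r + 2] *)

Section RankStep.
Local Open Scope complex_scope.
Variables (R : realType).
Local Notation C := R[i].
Implicit Types (p : {poly R}) (c : R -> R) (xs ys : seq R).

Definition qnum (theta : R) (r : nat) c xs := pf_num (fun x => qpow theta x r) c xs.
Definition qden (theta : R) (r : nat) xs := pf_den (fun x => qpow theta x r) xs.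

Lemma qnum_all_but_one_zero (theta : R) r c (x0 : R) xs (y : R) : 0 < y -> 0 <= theta -> r.-1%:R * theta < pi ->
  (forall x, x \in x0 :: xs -> 0 < x) ->
  (exists2 x, x \in x0 :: xs & c x != 0) -> (forall x, x \in xs -> c x = 0) ->
  (qnum theta r c (x0 :: xs)).[y] != 0.
Proof.
move=> y0 th0 hr xs0 [x + cx] c0; rewrite inE => /predU1P[xx0|/c0 cx0]; last by rewrite cx0 eqxx in cx.
rewrite /qnum /= pf_num_eq0 // mulr0 addr0 hornerZ mulf_neq0 -?xx0 //.
apply: pf_den_neq0 => z zxs; rewrite gt_eqF // qpow_gt0 //.
by apply: xs0; rewrite inE zxs orbT.
Qed.

(** [A / B] is the combination divided by the kernel of [x0], and [N] is the numerator of its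
    imaginary part on the ray. The hypothesis on [N] is used twice: to see that [N] is not zero, and
    to bound the number of its sign changes for [sector_rolle]. *)
Lemma qnum_step (theta : R) r c (x0 : R) xs ys : 0 < theta -> r.+1%:R * theta < pi ->
  uniq (x0 :: xs) -> (forall x, x \in x0 :: xs -> 0 < x) ->
  (forall zs : seq R, uniq zs -> (forall z, z \in zs -> 0 < z /\
     (qnum theta r.+2 (fun x => c x * (x - x0)) xs).[z] = 0) -> (size zs < size xs)%N) ->
  uniq ys -> (forall y, y \in ys -> 0 < y /\ (qnum theta r.+1 c (x0 :: xs)).[y] = 0) ->
  (size ys <= size xs)%N.
Proof.
move=> th0 hr uxs xs0 IH uys hys; rewrite leqNgt; apply/negP => sys.
have x0_gt0 : 0 < x0 by rewrite xs0 // mem_head.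
have xs_gt0 x : x \in xs -> 0 < x by move=> xxs; rewrite xs0 // inE xxs orbT.
have rth : r%:R * theta < pi by apply: le_lt_trans hr; rewrite ler_wpM2r ?ler_nat ?ltW.
set N := qnum theta r.+2 (fun x => c x * (x - x0)) xs.
set A := qnum theta r.+1 c (x0 :: xs); set B := qden theta r.+1 xs.
have vanish : (forall y, 0 < y -> N.[y] = 0) -> False.
  move=> h; have := IH [seq i.+1%:R | i <- iota 0 (size xs)].
  rewrite size_map size_iota ltnn => h'; suff: false by [].
  apply: h'; first by rewrite map_inj_uniq ?iota_uniq // => i j /eqP; rewrite eqr_nat => /eqP[].
  by move=> _ /mapP[i _ ->]; split; [rewrite ltr0n|apply: h; rewrite ltr0n].
have N0 : N != 0.
  by apply/eqP => N0; apply: vanish => y y0; rewrite N0 horner0.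
have qC (x t p : R) : 0 < x -> 0 <= p <= theta -> (qpow theta x r.+1)^:C.[cexp t p] != 0.
  move=> x_gt0 /andP[p0 p1]; have rp : p + r%:R * theta < pi.
    by apply: le_lt_trans hr; rewrite -natr1 mulrDl mul1r addrC lerD2l.
  apply: qpowC_neq0; rewrite ?(ltW th0) ?p0 //=.
  by apply: le_lt_trans rp; rewrite lerDl mulr_ge0 // ltW.
(* The term of [x0] gives the real constant [c x0]. In the other terms, given by [Im_qpow_quotient],
   the factors independent of [x] are positive; divided by the common denominator they form [u]. *)
have v_eq (t : R) : exists2 u, 0 < u &
    Im (A^:C.[cexp t theta] / B^:C.[cexp t theta]) = u * N.[expR t].
  set w := cexp t theta; set y := expR t.
  have y0 : 0 < y by exact: expR_gt0.
  have qw x : x \in xs -> (qpow theta x r.+1)^:C.[w] != 0.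
    by move=> /xs_gt0 x_gt0; apply: qC; rewrite ?lexx ?ltW.
  have den0 : B^:C.[w] != 0 by rewrite pf_den_map; apply: pf_den_neq0.
  have qy x : x \in xs -> (qpow theta x r.+2).[y] != 0.
    by move=> /xs_gt0 x_gt0; rewrite gt_eqF // qpow_gt0 // ltW.
  have D0 : 0 < (qden theta r.+2 xs).[y].
    rewrite /qden; elim: (xs) xs_gt0 => [|x s IHs] hs /=; first by rewrite hornerC.
    rewrite hornerM mulr_gt0 ?IHs //; last by move=> z zs; apply: hs; rewrite inE zs orbT.
    by apply: qpow_gt0 => //; [apply: hs; rewrite mem_head|rewrite ltW].
  set k := sin (r.+1%:R * theta) * y * (qpow theta x0 r).[y].
  have k0 : 0 < k.
    apply: mulr_gt0; first apply: mulr_gt0 => //.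
      by apply: sin_gt0_pi; rewrite hr mulr_gt0.
    apply: qpow_gt0 => //; first exact: ltW.
    by apply: le_lt_trans rth; rewrite ler_wpM2r ?ler_nat ?leq_pred ?ltW.
  exists (k / (qden theta r.+2 xs).[y]); first by rewrite divr_gt0.
  have -> : A^:C.[w] / B^:C.[w] = (c x0)%:C +
     \sum_(x <- xs) (c x)%:C * ((qpow theta x0 r.+1)^:C.[w] / (qpow theta x r.+1)^:C.[w]).
    have := pf_eval (fun x => (c x)%:C) qw.
    rewrite -pf_den_map -pf_num_map -/(qden _ _ _) -/B => E.
    rewrite /A /qnum /= -/(qden _ _ _) -/B rmorphD rmorphM /= map_polyZ.
    rewrite hornerD hornerZ hornerM mulrDl mulfK // -mulrA E mulr_sumr; congr (_ + _).
    by apply: eq_bigr => x _; rewrite mulrCA.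
  have Im_sum (s : seq R) (F : R -> C) : Im (\sum_(x <- s) F x) = \sum_(x <- s) Im (F x).
    elim: s => [|x s IHs]; first by rewrite !big_nil.
    by rewrite !big_cons ImD IHs.
  rewrite ImD Im_sum /= add0r -mulrA [_^-1 * _]mulrC pf_eval // mulr_sumr.
  rewrite big_seq [RHS]big_seq; apply: eq_bigr => x xxs.
  have E := Im_qpow_quotient t (xs_gt0 x xxs) x0_gt0 (ltW th0) hr.
  rewrite mulrC Im_mul_real E -/y -/k; ring.
have [P [uP hP sP]] := poly_sign_pattern N0.
have sizeP : (size P < size xs)%N by apply: IH.
(* On the logarithmic scale, the [size P + 1] smallest zeros serve as [ts] and the largest as [ts0];
   it lies outside [ts] since [size P + 1 <= size xs < size ys]. *)
pose s := sort <=%R (map (@ln R) ys).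
have lnexp : forall z : R, z \in ys -> expR (ln z) = z.
  by move=> z /hys[z0 _]; rewrite lnK // posrE.
have us : uniq s.
  rewrite sort_uniq map_inj_in_uniq // => u v uy vy E.
  by rewrite -(lnexp u uy) -(lnexp v vy) E.
have ss : size s = size ys by rewrite size_sort size_map.
have hs tau : tau \in s -> A.[expR tau] = 0.
  by rewrite mem_sort => /mapP[z zys ->]; rewrite lnexp //; have [] := hys z zys.
have sorted_s : sorted <%R s by rewrite lt_sorted_uniq_le us sort_le_sorted.
have sP1 : (size P).+1 = size (take (size P).+1 s).
  by rewrite size_takel // ss; apply: leq_trans sys; exact: ltnW.
have last_in : ((size ys).-1 < size s)%N by rewrite ss prednK // (leq_ltn_trans _ sys).
have lnP z : z \in P -> expR (ln z) = z by move=> /hP[z0 _]; rewrite lnK // posrE.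
have mB := fun x => (qpow_monic theta x r.+1).1.
have sB := fun x => (qpow_monic theta x r.+1).2.
(* [e] normalises the sign of the pattern, being [-1] or [1] below. The choice [kappa = pi / theta]
   puts the upper edge of the strip at [p = theta]. *)
have contra_core (e : R) : e != 0 ->
    (forall y, 0 < y -> e * (N.[y] * \prod_(z <- P) (y - z)) <= 0) -> False.
  move=> e0 hsgn.
  have kE : pi / (pi / theta) = theta :> R.
    by rewrite invf_div mulrCA divff ?mulr1 // gt_eqF ?pi_gt0.
  have kpi (p : R) : 0 <= pi / theta * p <= pi -> 0 <= p <= theta.
    rewrite mulrAC pmulr_lge0 ?invr_gt0 // pmulr_rge0 ?pi_gt0 // ler_pdivrMr //.
    by rewrite ler_pM2l // pi_gt0.
  apply: (@sector_rolle R (pi / theta) (e *: A) B (map (@ln R) P)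
     (take (size P).+1 s) (nth 0 s (size ys).-1)).
  - by rewrite divr_gt0 ?pi_gt0.
  - rewrite scaler_eq0 negb_or e0 /=; apply/eqP => A0.
    apply: vanish => z z0; have [u u0] := v_eq (ln z).
    rewrite A0 rmorph0 horner0 mul0r lnK ?posrE // => /esym/eqP.
    by rewrite mulf_eq0 gt_eqF //= => /eqP.
  - have [_ ->] := size_pf_den xs mB sB.
    by apply: (leq_trans (size_scale_leq _ _)); exact: size_pf_num.
  - by apply: pf_den_neq0 => x /xs_gt0 x_gt0; rewrite qpow_at0 expf_neq0 // gt_eqF.
  - move=> t p /kpi pth; rewrite pf_den_map; apply: pf_den_neq0 => x /xs_gt0 x_gt0.
    exact: qC.
  - by apply: take_uniq.
  - by rewrite size_map -sP1.
  - move=> tau /(nthP 0) [j + <-]; rewrite -sP1 => jP; rewrite nth_take //.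
    have jys : (j < (size ys).-1)%N.
      rewrite -ltnS prednK; first exact: (leq_ltn_trans (leq_trans jP sizeP) sys).
      exact: leq_ltn_trans sys.
    apply: (sorted_ltn_nth lt_trans) => //; rewrite inE //.
    by rewrite ss (leq_trans jys) // leq_pred.
  - by move=> tau /mem_take/hs At; rewrite hornerZ At mulr0.
  - by rewrite hornerZ hs ?mulr0 // mem_nth.
  - move=> t; rewrite kE map_polyZ hornerZ -mulrA mulrC -[_ * (_ / _)]mulrC.
    rewrite Im_mul_real big_map.
    have [u u0 ->] := v_eq t.
    have -> : \prod_(j <- P) (expR t - expR (ln j)) = \prod_(j <- P) (expR t - j).
      by rewrite big_seq [RHS]big_seq; apply: eq_bigr => z /lnP ->.
    have := hsgn _ (expR_gt0 t); set Q := \prod_(z <- P) _ => hQ.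
    have -> : Q * (u * N.[expR t] * e) = u * (e * (N.[expR t] * Q)) by ring.
    by rewrite mulr_ge0_le0 // ltW.
case: sP => h.
  by apply: (contra_core (-1)) => [|y /h]; rewrite ?oppr_eq0 ?oner_eq0 // mulN1r oppr_le0.
by apply: (contra_core 1) => [|y /h]; rewrite ?oner_eq0 // mul1r.
Qed.
End RankStep.

Local Arguments qpow : simpl never.

(** * Zero counts for all admissible angles *)

Section KernelZeros.
Local Open Scope complex_scope.
Variables (R : realType).
Implicit Types (p : {poly R}) (c : R -> R) (xs ys : seq R).

(** In the variable [y^(k + 1)] these are plain Cauchy sums: their numerator has degree below
    [size xs], and it is nonzero because it does not vanish at the pole of a term with
    [c x != 0]. *)
Lemma qnum_zero_count_full (theta : R) k c xs ys : 0 < theta -> k.+1%:R * theta = pi ->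
  uniq xs -> (forall x, x \in xs -> 0 < x) -> (exists2 x, x \in xs & c x != 0) ->
  uniq ys -> (forall y, y \in ys -> 0 < y /\ (qnum theta k.+1 c xs).[y] = 0) ->
  (size ys < size xs)%N.
Proof.
move=> th0 hk uxs xs0 [x xxs cx] uys hys.
have powI : {in [pred z : R | 0 < z] &, injective (fun z : R => z ^+ k.+1)}.
  by move=> u v /[!inE] u0 v0 /eqP; rewrite eqrXn2 ?ltW // => /eqP.
pose L x : {poly R} := 'X + (x ^+ k.+1)%:P.
have LE : (fun x => qpow theta x k.+1) = (fun x => L x \Po 'X^(k.+1)).
  by apply/funext => z; rewrite (qpow_full _ th0 hk) comp_polyD comp_polyX comp_polyC.
have LX z : L z = 'X - (- z ^+ k.+1)%:P by rewrite /L polyCN opprK.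
set N := pf_num L c xs.
have NE : qnum theta k.+1 c xs = N \Po 'X^(k.+1) by rewrite /qnum LE pf_num_comp.
have N0 : N != 0.
  have h : N.[- x ^+ k.+1] != 0.
    apply: (pf_num_pole uxs xxs cx); first by rewrite !hornerE addNr.
    move=> z zxs; apply: contraNneq; rewrite !hornerE addrC => /eqP; rewrite subr_eq0 => /eqP.
    by move=> /powI -> //; rewrite inE xs0.
  by apply: contraNneq h => ->; rewrite horner0.
have sN : (size N <= size xs)%N.
  rewrite /N; case: (xs) => [|z s]; first by rewrite size_poly0.
  rewrite -[size (z :: s)]/(size s).+1 -[size s]mul1n; apply: size_pf_num => u.
    by rewrite LX monicXsubC.
  by rewrite LX size_XsubC.
apply: leq_trans sN; rewrite -(size_map (fun z : R => z ^+ k.+1) ys).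
apply: max_poly_roots => //.
  apply/allP => _ /mapP[y yys ->]; apply/rootP; have [_] := hys y yys.
  by rewrite NE horner_comp hornerXn.
rewrite map_inj_in_uniq // => u v /hys[u0 _] /hys[v0 _]; exact: powI.
Qed.

(** Each step raises the rank by one and removes a node, so [r + size xs] is constant and the first
    condition persists. Under the second, the rank may reach [k], where [qnum_zero_count_full]
    concludes. *)
Lemma qnum_zero_count (theta : R) xs ys c r : 0 < theta ->
  (r + size xs).-1%:R * theta < pi \/ (exists2 k, k%:R * theta = pi & (r < k)%N) ->
  uniq xs -> (forall x, x \in xs -> 0 < x) -> (exists2 x, x \in xs & c x != 0) ->
  uniq ys -> (forall y, y \in ys -> 0 < y /\ (qnum theta r.+1 c xs).[y] = 0) ->
  (size ys < size xs)%N.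
Proof.
move=> th0; elim: xs ys r c => [|x0 xs IH] ys r c hr uxs xs0 cx uys hys.
  by case: cx.
have hr1 : r%:R * theta < pi.
  case: hr => [|[k <- rk]]; last by rewrite ltr_pM2r // ltr_nat.
  by apply: le_lt_trans; rewrite ler_pM2r // ler_nat /= addnS leq_addr.
(* If only [x0] carries a nonzero coefficient, the new weights [c x (x - x0)] all vanish and the
   induction stops; but a single term has no positive zero. *)
case: (boolP (all (fun x => c x == 0) xs)) => [/allP c0|/allPn[x1 x1xs cx1]].
  rewrite ltnNge; apply/negP; case: ys uys hys => // y ys _ hys _.
  have [y0 /eqP] := hys y (mem_head _ _); apply/negP.
  by apply: qnum_all_but_one_zero => //; [exact: ltW|move=> x /c0/eqP].
have xs_gt0 : (0 < size xs)%N by case: (xs) x1xs.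
have [[k hk rk]|hr2] : (exists2 k, k%:R * theta = pi & r.+1 = k) \/ (r.+1%:R * theta < pi).
  case: hr => [hr|[k hk]]; last first.
    by rewrite leq_eqVlt => /predU1P[rk|rk]; [left; exists k|right; rewrite -hk ltr_pM2r // ltr_nat].
  right; apply: le_lt_trans hr; rewrite ler_pM2r // ler_nat /= addnS /=.
  by rewrite -[r.+1]addn1 leq_add2l.
- by apply: (qnum_zero_count_full th0 _ uxs xs0 cx uys hys); rewrite rk.
rewrite ltnS; apply: (qnum_step th0 hr2 uxs xs0 _ uys hys) => zs uzs hzs.
have /andP[x0xs uxs'] := uxs.
apply: (IH zs r.+1 _ _ uxs' _ _ uzs hzs).
- case: hr => [hr|[k hk]]; first by left; rewrite addSnnS.
  rewrite leq_eqVlt => /predU1P[rk|rk]; first by move: hr2; rewrite rk hk ltxx.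
  by right; exists k.
- by move=> x xxs; rewrite xs0 // inE xxs orbT.
- exists x1 => //; rewrite mulf_neq0 // subr_eq0.
  by apply: contraNneq x0xs => <-.
Qed.

(** The [path] conclusion keeps the zeros of [df] distinct and positive, as the next application of
    the count requires. *)
Lemma rolle_seq (f df : R -> R) (y : R) ys :
  (forall t : R, 0 < t -> is_derive t 1 f (df t)) -> 0 < y -> path <%R y ys ->
  (forall z, z \in y :: ys -> f z = 0) ->
  exists zs, [/\ size zs = size ys, path <%R y zs & forall z, z \in zs -> df z = 0].
Proof.
move=> hf; elim: ys y => [|z ys IH] y y0 /=; first by exists [::].
move=> /andP[yz zys] h.
have z0 := lt_trans y0 yz.
have [|zs [szs pzs hzs]] := IH z z0 zys.
  by move=> u uz; apply: h; rewrite inE uz orbT.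
have [u|||u uyz [du dfu]] := @Rolle R f y z yz.
- by rewrite in_itv /= => /andP[yu _]; have [] := hf u (lt_trans y0 yu).
- apply: derivable_within_continuous => u; rewrite in_itv /= => /andP[yu _].
  by have [] := hf u (lt_le_trans y0 yu).
- by rewrite !h // !inE eqxx ?orbT.
move: uyz; rewrite in_itv /= => /andP[yu uz].
exists (u :: zs); rewrite /= szs yu; split => //.
  by case: (zs) pzs => //= v vs /andP[zv ->]; rewrite (lt_trans uz zv).
move=> v; rewrite inE => /predU1P[->|/hzs //].
by have [_ <-] := hf u (lt_trans y0 yu).
Qed.

Lemma is_derive_moebius_pow (a b c y : R) n : 0 < y + b ->
  is_derive y 1 (fun y => c * ((y + a) / (y + b)) ^+ n.+1)
   (n.+1%:R * (y + a) ^+ n * (c * (b - a) / (y + b) ^+ n.+2)).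
Proof.
move=> yb; have nb : y + b != 0 by rewrite gt_eqF.
have hb : is_derive y 1 (fun y : R => y + b) 1.
  by apply: is_derive_eq; rewrite addr0.
have hV := @is_derive1V _ (fun y : R => y + b) _ _ nb hb.
have h1 : is_derive y 1 (fun y : R => (y + a) / (y + b)) ((b - a) / (y + b) ^+ 2).
  by apply: is_derive_eq; rewrite /GRing.scale /=; field.
have h2 := @is_deriveX R R (fun y : R => (y + a) / (y + b)) n.+1 y 1 _ h1.
rewrite exprfctE in h2.
have h3 : is_derive y 1 (fun y0 : R => c * ((y0 + a) / (y0 + b)) ^+ n.+1) _ :=
  is_deriveZ c h2.
apply: is_derive_eq; rewrite /GRing.scale /= exprMn exprVn !exprS; field.
by rewrite nb expf_neq0.
Qed.

(** The case [theta = 0]. After multiplication by [(y + x0)^(r + 1)], the derivative is a positive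
    multiple of the sum with exponent [r + 2] over [xs] with weights [c x (x - x0)], and Rolle's
    theorem loses one zero. *)
Lemma cauchy_power_zero_count xs ys c r :
  uniq xs -> (forall x, x \in xs -> 0 < x) -> (exists2 x, x \in xs & c x != 0) ->
  uniq ys -> (forall y, y \in ys -> 0 < y /\ \sum_(x <- xs) c x / (y + x) ^+ r.+1 = 0) ->
  (size ys < size xs)%N.
Proof.
elim: xs ys r c => [|x0 xs IH] ys r c uxs xs0 cx uys hys; first by case: cx.
have x0_gt0 : 0 < x0 by rewrite xs0 // mem_head.
have xs_gt0 x : x \in xs -> 0 < x by move=> xxs; rewrite xs0 // inE xxs orbT.
have /andP[x0xs uxs'] := uxs.
case: (boolP (all (fun x => c x == 0) xs)) => [/allP c0|/allPn[x1 x1xs cx1]].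
  rewrite ltnNge; apply/negP; case: ys uys hys => // y ys _ hys _.
  have [y0] := hys y (mem_head _ _).
  rewrite big_cons big_seq big1 ?addr0; last by move=> x /c0/eqP ->; rewrite mul0r.
  have cx0 : c x0 != 0.
    by case: cx => x; rewrite inE => /predU1P[->|/c0/eqP ->]; rewrite ?eqxx.
  by apply/eqP; rewrite mulf_neq0 // invr_eq0 expf_neq0 // gt_eqF ?addr_gt0.
rewrite ltnS; pose s := sort <=%R ys.
have us : uniq s by rewrite sort_uniq.
have sorted_s : sorted <%R s by rewrite lt_sorted_uniq_le us sort_le_sorted.
rewrite -(size_sort <=%R) -/s.
pose f (y : R) := \sum_(x <- x0 :: xs) c x * ((y + x0) / (y + x)) ^+ r.+1.
pose df (y : R) := r.+1%:R * (y + x0) ^+ r *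
  \sum_(x <- xs) c x * (x - x0) / (y + x) ^+ r.+2.
have hf (t : R) : 0 < t -> is_derive t 1 f (df t).
  move=> t0.
  have -> : df t = \sum_(x <- x0 :: xs) r.+1%:R * (t + x0) ^+ r *
      (c x * (x - x0) / (t + x) ^+ r.+2).
    by rewrite big_cons subrr mulr0 mul0r mulr0 add0r /df mulr_sumr.
  rewrite /f; elim: (x0 :: xs) xs0 => [|x u IHu] hu.
    under eq_fun do rewrite big_nil; rewrite big_nil; exact: is_derive_cst.
  under eq_fun do rewrite big_cons; rewrite big_cons.
  apply: is_deriveD; last by apply: IHu => z zu; apply: hu; rewrite inE zu orbT.
  by apply: is_derive_moebius_pow; rewrite addr_gt0 // hu ?mem_head.
have fE (y : R) : 0 < y -> f y = (y + x0) ^+ r.+1 * \sum_(x <- x0 :: xs) c x / (y + x) ^+ r.+1.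
  by move=> y0; rewrite mulr_sumr; apply: eq_bigr => x _; rewrite exprMn exprVn; ring.
have ss y : y \in s -> 0 < y /\ f y = 0.
  by rewrite mem_sort => /hys[y0 gy]; split => //; rewrite fE // gy mulr0.
case: (s) sorted_s ss => [|y t] // /= pyt ht.
have [y0 _] := ht y (mem_head _ _).
have [zs [szs pzs hzs]] := rolle_seq hf y0 pyt (fun z zin => (ht z zin).2).
rewrite -szs; apply: (IH zs r.+1 (fun x => c x * (x - x0))) => //.
- exists x1 => //; rewrite mulf_neq0 // subr_eq0.
  by apply: contraNneq x0xs => <-.
- by apply: (sorted_uniq lt_trans ltxx); exact: path_sorted pzs.
- move=> z zzs; have z0 : 0 < z.
    by have /allP/(_ z zzs)/(lt_trans y0) := order_path_min lt_trans pzs.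
  split => //; have /eqP := hzs z zzs; rewrite mulf_eq0 => /orP[|/eqP //].
  by rewrite mulf_eq0 pnatr_eq0 /= expf_eq0 gt_eqF ?addr_gt0 // andbF.
Qed.

Lemma qpow0 (x : R) r : qpow 0 x r = ('X + x%:P) ^+ r.
Proof.
elim/qpow_ind: r => [||r IH] //.
rewrite qpowSS IH -addn2 exprD; congr (_ * _).
rewrite /qfactor mulr0 cos0 mulr1 -mul_polyC (rmorphM (@polyC R)) (rmorphXn (@polyC R)) rmorph_nat; ring.
Qed.

(* The parameters [theta = pi alpha] for which [K_alpha] turns out to be [STP_n] *)
Definition admissible (theta : R) (n : nat) : Prop :=
  [\/ theta = 0, 0 < theta /\ n%:R * theta < pi
    | 0 < theta /\ exists2 k, k%:R * theta = pi & (1 < k)%N].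

(** The kernel has rank [2], so the count is taken at [r = 1]: [(r + size xs).-1] is then [size xs],
    and [r < k] reads [1 < k], as in [admissible]. *)
Lemma kernel_zero_count (theta : R) xs ys c : admissible theta (size xs) ->
  uniq xs -> (forall x, x \in xs -> 0 < x) -> (exists2 x, x \in xs & c x != 0) ->
  uniq ys -> (forall y, y \in ys -> 0 < y /\ \sum_(x <- xs) c x / (qpow theta x 2).[y] = 0) ->
  (size ys < size xs)%N.
Proof.
move=> adm uxs xs0 cx uys hys.
have num0 y : 0 < theta -> theta < pi -> 0 < y ->
    \sum_(x <- xs) c x / (qpow theta x 2).[y] = 0 -> (qnum theta 2 c xs).[y] = 0.
  move=> th0 thpi y0.
  have q0 x : x \in xs -> (qpow theta x 2).[y] != 0.
    by move=> /xs0 x_gt0; rewrite gt_eqF // qpow_gt0 ?(ltW th0) // mul1r.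
  rewrite -pf_eval // => /eqP; rewrite mulf_eq0 invr_eq0 => /orP[/eqP //|].
  by rewrite (negbTE (pf_den_neq0 q0)).
case: adm => [th0|[th0 hn]|[th0 [k hk k1]]].
- apply: (@cauchy_power_zero_count xs ys c 1) => // y /hys[y0 hy]; split => //.
  by rewrite -[RHS]hy; apply: eq_bigr => x _; rewrite th0 qpow0 !hornerE.
all: have sxs : (0 < size xs)%N by case: cx => x; case: (xs).
all: have th_pi : theta < pi.
- by apply: le_lt_trans hn; rewrite ler_peMl ?(ltW th0) // ler1n.
- apply: (@qnum_zero_count theta xs ys c 1) => //; first by left.
  by move=> y /hys[y0 hy]; split => //; apply: num0 hy.
- by rewrite -hk ltr_pMl // ltr1n.
apply: (@qnum_zero_count theta xs ys c 1) => //; first by right; exists k.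
by move=> y /hys[y0 hy]; split => //; apply: num0 hy.
Qed.
End KernelZeros.

Local Arguments qpow : simpl never.

(** * Minors of the kernel *)

Section Minors.
Local Open Scope classical_set_scope.
Variables (R : realType).

Lemma det_cvg (T : Type) (F : set_system T) {FF : Filter F} m
    (f : T -> 'I_m -> 'I_m -> R) (a : 'I_m -> 'I_m -> R) :
  (forall i j, (fun q => f q i j) @ F --> a i j) ->
  (fun q => \det (\matrix_(i, j) f q i j)) @ F --> \det (\matrix_(i, j) a i j).
Proof.
move=> hf; rewrite /determinant.
apply: (@cvg_big R _ +%R 0 _ _ _ F) => [|s _]; first exact: add_continuous.
apply: cvgM; first exact: cvg_cst.
apply: (@cvg_big R _ *%R 1 _ _ _ F) => [|i _]; first exact: mul_continuous.
by rewrite mxE; under eq_fun do rewrite mxE; exact: hf.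
Qed.

Lemma Kalpha_qpow (alpha x y : R) : Kalpha alpha x y = ((qpow (pi * alpha) x 2).[y])^-1.
Proof.
by rewrite qpowSS hornerM hornerC mul1r horner_qfactor mul1r /Kalpha; congr (_^-1); ring.
Qed.

Lemma Kalpha_den_gt0 (alpha x y : R) : 0 <= alpha < 1 -> 0 < x -> 0 < y ->
  0 < x ^+ 2 + 2 * cos (pi * alpha) * x * y + y ^+ 2.
Proof.
move=> /andP[a0 a1] x0 y0.
have := @qpow_gt0 R (pi * alpha) x 2 y x0 y0; rewrite mul1r mulr_ge0 ?pi_ge0 //.
rewrite gtr_pMr ?pi_gt0 // => /(_ isT a1).
by rewrite qpowSS hornerM hornerC mul1r horner_qfactor mul1r; congr (_ < _); ring.
Qed.

Lemma admissible_le (theta : R) m n : (m <= n)%N -> admissible theta n -> admissible theta m.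
Proof.
move=> mn [h|[th0 h]|h]; [by constructor 1|constructor 2|by constructor 3].
by split => //; apply: le_lt_trans h; rewrite ler_pM2r // ler_nat.
Qed.

(** A nonzero vector in the left kernel of the matrix is a combination of [m] kernels vanishing at
    the [m] points [y j], one more than is possible. *)
Lemma kminor_neq0 (alpha : R) m (x y : 'I_m -> R) : admissible (pi * alpha) m ->
  incr_pos x -> incr_pos y -> kminor (Kalpha alpha) x y != 0.
Proof.
move=> adm [x0 xlt] [y0 ylt].
have incr_inj (z : 'I_m -> R) : (forall i j : 'I_m, (i < j)%N -> z i < z j) -> injective z.
  move=> zlt i j zij; case: (ltngtP i j) => [/zlt|/zlt|/val_inj //]; by rewrite zij ltxx.
have xI := incr_inj x xlt; have yI := incr_inj y ylt.
apply/det0P => -[v v0 vM].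
(* Turns coefficients indexed by position into a function of the node; as [x] is injective, the sum
   has a single term at each node. *)
pose c u := \sum_(i | x i == u) v 0 i.
have cx i : c (x i) = v 0 i.
  rewrite /c (eq_bigl (fun j => j == i)) ?big_pred1_eq // => j.
  by apply/eqP/eqP => [/xI|->].
suff : (size [seq y i | i <- enum 'I_m] < size [seq x i | i <- enum 'I_m])%N.
  by rewrite !size_map ltnn.
apply: (@kernel_zero_count R (pi * alpha) [seq x i | i <- enum 'I_m] _ c).
- by rewrite size_map size_enum_ord.
- by rewrite map_inj_uniq // enum_uniq.
- by move=> _ /mapP[i _ ->].
- have [i vi] : exists i, v 0 i != 0.
    by apply/existsP; apply: contraNT v0 => /existsPn h; apply/eqP/rowP => i; rewrite mxE; apply/eqP/negPn.
  by exists (x i); [rewrite map_f ?mem_enum|rewrite cx].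
- by rewrite map_inj_uniq // enum_uniq.
- move=> _ /mapP[j _ ->]; split => //.
  have := congr1 (fun M : 'rV_m => M 0 j) vM; rewrite !mxE => E.
  rewrite -[RHS]E big_map big_enum /=; apply: eq_bigr => i _.
  by rewrite cx mxE Kalpha_qpow.
Qed.

(** At the nodes [u^(- i)], extracting [u^i] from row [i] and [u^j] from column [j] leaves entries
    of order [u^|i - j|]; as [u -> 0] the matrix tends to a positive multiple of the identity. *)
Lemma geometric_minor_gt0 (alpha : R) m : 0 <= alpha < 1 ->
  exists2 x : 'I_m -> R, incr_pos x & 0 < kminor (Kalpha alpha) x x.
Proof.
move=> a01; set c := cos (pi * alpha).
have d0 : 0 < 2 + 2 * c.
  by have := Kalpha_den_gt0 a01 ltr01 ltr01; rewrite expr1n !mulr1 -/c; lra.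
(* Natural subtraction truncates at [0], so this sum is [|i - j|]. *)
pose k (i j : 'I_m) := ((i - j) + (j - i))%N.
pose f (u : R) i j := u ^+ k i j / (1 + 2 * c * u ^+ k i j + (u ^+ k i j) ^+ 2).
have kii i : k i i = 0%N by rewrite /k subnn.
have kij i j : i != j -> (0 < k i j)%N.
  rewrite /k addn_gt0 !subn_gt0 => ij.
  by case: (ltngtP i j) => // /val_inj ij'; rewrite ij' eqxx in ij.
have f0 i j : f 0 i j = (i == j)%:R / (2 + 2 * c).
  rewrite /f; case: eqVneq => [->|/kij]; last by move=> hk; rewrite expr0n (gtn_eqF hk) !mul0r.
  by rewrite kii expr0; congr (_ / _); ring.
have hf i j : (fun u => f u i j) @ 0^'+ --> f 0 i j.
  apply: cvg_at_right_filter.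
  have cX : (fun u : R => u ^+ k i j) @ (nbhs (0 : R)) --> (0 : R) ^+ k i j by exact: exprn_continuous.
  have n0 : 1 + 2 * c * 0 ^+ k i j + (0 ^+ k i j) ^+ 2 != 0 :> R.
    case: (posnP (k i j)) => [->|hk].
      by rewrite expr0 gt_eqF //; move: d0; rewrite mulr1 expr1n; lra.
    by rewrite expr0n (gtn_eqF hk) mulr0 expr0n /= !addr0 oner_eq0.
  apply: cvgM => //; apply: cvgV => //.
  apply: (@cvgD _ R^o); first apply: (@cvgD _ R^o); first exact: cvg_cst.
    by apply: cvgM => //; exact: cvg_cst.
  by rewrite expr2; under eq_fun do rewrite expr2; exact: cvgM.
have D0 : 0 < \det (\matrix_(i, j) f 0 i j).
  have -> : \matrix_(i, j) f 0 i j = (2 + 2 * c)^-1%:M.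
    by apply/matrixP => i j; rewrite !mxE f0 mulr_natl.
  by rewrite det_scalar exprn_gt0 // invr_gt0.
have [u [[u0 u1] du]] := @filter_ex _ (0 : R)^'+ _ _
  (filterI (filterI (nbhs_right_gt (0 : R)) (nbhs_right_lt (ltr01 : (0 : R) < 1)))
    (cvgr_gt _ (det_cvg hf) 0 D0)).
have un i : 0 < u ^+ i by rewrite exprn_gt0.
exists (fun i : 'I_m => (u ^+ i)^-1).
  split => [i|i j ij]; first by rewrite invr_gt0.
  by rewrite ltf_pV2 ?posrE // ltr_iXn2l.
have key (i j : 'I_m) : Kalpha alpha (u ^+ i)^-1 (u ^+ j)^-1 = u ^+ i * f u i j * u ^+ j.
  rewrite /Kalpha -/c /f; set w := u ^+ k i j.
  have w0 : 0 < w by rewrite exprn_gt0.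
  have den0 : 1 + 2 * c * w + w ^+ 2 != 0.
    have := Kalpha_den_gt0 a01 ltr01 w0; rewrite expr1n mulr1 -/c => h.
    by rewrite gt_eqF.
  case: (leqP i j) => ij.
    have -> : u ^+ j = u ^+ i * w.
      by rewrite /w /k (eqP ij) add0n -exprD subnKC.
    by have := un i; set A := u ^+ i => A0; field; rewrite den0 !gt_eqF.
  have -> : u ^+ i = u ^+ j * w.
    by rewrite /w /k (eqP (ltnW ij)) addn0 -exprD subnKC // ltnW.
  have := un j; set A := u ^+ j => A0; field.
  by rewrite den0 !gt_eqF.
pose E : 'rV[R]_m := \row_i u ^+ i.
have -> : kminor (Kalpha alpha) (fun i : 'I_m => (u ^+ i)^-1) (fun i : 'I_m => (u ^+ i)^-1) =
   \det (diag_mx E *m (\matrix_(i, j) f u i j) *m diag_mx E).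
  congr (\det _); apply/matrixP => i j; rewrite mul_mx_diag mul_diag_mx !mxE key //.
rewrite !det_mulmx det_diag !mulr_gt0 //; apply: prodr_gt0 => i _; by rewrite mxE.
Qed.

(** Along the segment joining the two pairs of tuples, a change of sign would produce a zero minor
    at admissible nodes, against [kminor_neq0]. *)
Lemma kminor_segment (alpha : R) m (x y x' y' : 'I_m -> R) :
  0 <= alpha < 1 -> admissible (pi * alpha) m ->
  incr_pos x -> incr_pos y -> incr_pos x' -> incr_pos y' ->
  0 < kminor (Kalpha alpha) x' y' -> 0 < kminor (Kalpha alpha) x y.
Proof.
move=> a01 adm hx hy hx' hy' pos'.
pose seg (z z' : 'I_m -> R) (t : R) i := z i + t * (z' i - z i).
have seg_incr z z' t : incr_pos z -> incr_pos z' -> 0 <= t <= 1 -> incr_pos (seg z z' t).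
  move=> [z0 zl] [z'0 z'l] /andP[t0 t1]; split => [i|i j ij]; rewrite /seg.
    have := z0 i; have := z'0 i => h1 h2.
    have -> : z i + t * (z' i - z i) = (1 - t) * z i + t * z' i by ring.
    move: t1; rewrite le_eqVlt => /predU1P[->|t1]; first by rewrite subrr mul0r add0r mul1r.
    by rewrite ltr_pwDl ?mulr_gt0 ?subr_gt0 // mulr_ge0 // ltW.
  have := zl i j ij; have := z'l i j ij => h1 h2.
  rewrite -subr_gt0.
  have -> : z j + t * (z' j - z j) - (z i + t * (z' i - z i)) =
     (1 - t) * (z j - z i) + t * (z' j - z' i) by ring.
  move: t1; rewrite le_eqVlt => /predU1P[->|t1].
    by rewrite subrr mul0r add0r mul1r subr_gt0.
  by rewrite ltr_pwDl ?mulr_gt0 ?subr_gt0 // mulr_ge0 // subr_ge0 ltW.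
pose phi t := kminor (Kalpha alpha) (seg x x' t) (seg y y' t).
have phi1 : phi 1 = kminor (Kalpha alpha) x' y'.
  by congr (\det _); apply/matrixP => i j; rewrite !mxE /seg !mul1r ![_ + (_ - _)]addrC !subrK.
have phi0 : phi 0 = kminor (Kalpha alpha) x y.
  by congr (\det _); apply/matrixP => i j; rewrite !mxE /seg !mul0r !addr0.
have cphi : {within `[0, 1], continuous phi}.
  apply: (@continuous_in_subspaceT _ _ `[(0 : R), 1]) => t.
  rewrite inE /= in_itv /= => t01; apply: det_cvg => i j; rewrite /Kalpha.
  have cseg z z' l : (fun q : R => seg z z' q l) @ (nbhs t) --> seg z z' t l.
    apply: (@cvgD _ R^o); first exact: cvg_cst.
    by apply: cvgM; [exact: cvg_id|exact: cvg_cst].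
  have [sx _] := seg_incr x x' t hx hx' t01; have [sy _] := seg_incr y y' t hy hy' t01.
  apply: cvgV; first by rewrite gt_eqF // Kalpha_den_gt0.
  apply: (@cvgD _ R^o); first apply: (@cvgD _ R^o).
  - by rewrite expr2; under eq_fun do rewrite expr2; apply: cvgM; exact: cseg.
  - by apply: cvgM; [apply: cvgM; [exact: cvg_cst|exact: cseg]|exact: cseg].
  - by rewrite expr2; under eq_fun do rewrite expr2; apply: cvgM; exact: cseg.
rewrite ltNge; apply/negP => neg.
have [|t t01 pt] := @IVT R phi 0 1 0 ler01 cphi.
  by rewrite phi0 phi1 ge_min neg /= le_max (ltW pos') orbT.
move: t01; rewrite in_itv /= => t01; have := kminor_neq0 adm
  (seg_incr x x' t hx hx' t01) (seg_incr y y' t hy hy' t01).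
by rewrite -/(phi t) pt eqxx.
Qed.

Lemma STP_admissible (alpha : R) n : 0 <= alpha < 1 -> admissible (pi * alpha) n ->
  STP (Kalpha alpha) n.
Proof.
move=> a01 adm m /andP[_ mn] x y hx hy.
have [z hz zpos] := @geometric_minor_gt0 alpha m a01.
exact: (kminor_segment a01 (admissible_le mn adm) hx hy hz hz zpos).
Qed.
End Minors.

(** * A negative minor from the Chebyshev expansion of the kernel *)

Section NegativeMinor.
Local Open Scope classical_set_scope.
Variables (R : realType).

(** The value [U_l (cos theta)] of the Chebyshev polynomial of the second kind. *)
Definition chebU (theta : R) (l : nat) : R := sin (l.+1%:R * theta) / sin theta.

Lemma chebU_rec (theta : R) l :
  chebU theta l.+2 = 2 * cos theta * chebU theta l.+1 - chebU theta l.
Proof.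
rewrite /chebU; set a := l.+2%:R * theta.
have -> : l.+3%:R * theta = a + theta by rewrite -[l.+3%:R]natr1 mulrDl mul1r.
have -> : l.+1%:R * theta = a - theta.
  by rewrite /a -[l.+2%:R]natr1 mulrDl mul1r addrK.
by rewrite sinB sinD; ring.
Qed.

(** The generating function of the Chebyshev polynomials at [- tau], truncated with an exact
    remainder that the three-term recurrence carries from [m] to [m + 1]. *)
Lemma chebU_series (theta tau : R) m : sin theta != 0 -> 1 + 2 * cos theta * tau + tau ^+ 2 != 0 ->
  (1 + 2 * cos theta * tau + tau ^+ 2)^-1 =
  \sum_(l < m.+1) chebU theta l * (- tau) ^+ l + (- tau) ^+ m.+1 *
    ((chebU theta m.+1 + chebU theta m * tau) / (1 + 2 * cos theta * tau + tau ^+ 2)).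
Proof.
move=> s0 d0; apply: (mulIf d0); rewrite mulVf // mulrDl -[_ * (_ / _) * _]mulrA divfK //.
have U0 : chebU theta 0 = 1 by rewrite /chebU mul1r divff.
have U1 : chebU theta 1 = 2 * cos theta.
  rewrite /chebU mulr_natl mulr2n sinD; field; exact: s0.
elim: m => [|m IH].
  by rewrite big_ord1 U0 U1 expr0 expr1; ring.
apply: (etrans IH); rewrite [in RHS]big_ord_recr /= chebU_rec.
rewrite [(- tau) ^+ m.+2]exprS; set P := (- tau) ^+ m.+1; ring.
Qed.

Lemma vandermonde_gt0 m (a : 'rV[R]_m) : (forall i j : 'I_m, (i < j)%N -> a 0 i < a 0 j) ->
  0 < \det (Vandermonde m a).
Proof.
move=> ha; rewrite det_Vandermonde prodr_gt0 // => i _.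
by rewrite prodr_gt0 // => j ij; rewrite subr_gt0 ha.
Qed.

(* As the nodes [x] shrink to [0], the minor is governed by [prod_(l < m) U_l(cos theta)]. *)
Lemma small_nodes_minor_lt0 (alpha : R) m : 0 < alpha < 1 ->
  \prod_(l < m.+1) chebU (pi * alpha) l < 0 ->
  exists x y : 'I_m.+1 -> R, [/\ incr_pos x, incr_pos y & kminor (Kalpha alpha) x y < 0].
Proof.
move=> /andP[a0 a1] hU; set theta := pi * alpha in hU *.
have a01 : 0 <= alpha < 1 by rewrite (ltW a0).
have s0 : sin theta != 0.
  by rewrite gt_eqF // sin_gt0_pi // mulr_gt0 ?pi_gt0 //= gtr_pMr ?pi_gt0.
pose aa (i : 'I_m.+1) : R := i.+1%:R.
have aa0 i : 0 < aa i by rewrite ltr0n.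
pose a : 'rV[R]_m.+1 := \row_i aa i.
pose y (j : 'I_m.+1) : R := j.+1%:R.
have y0 j : 0 < y j by rewrite ltr0n.
(* The sign comes from the powers of [- tau], and makes these nodes increase with [j], so that their
   Vandermonde determinant is positive. *)
pose b : 'rV[R]_m.+1 := \row_j - (y j)^-1.
pose V := (Vandermonde m.+1 a)^T.
have dV : 0 < \det V.
  by rewrite det_tr vandermonde_gt0 // => i j ij; rewrite !mxE ltr_nat.
have Vunit : V \in unitmx by rewrite unitmxE unitfE gt_eqF.
pose D : 'rV[R]_m.+1 := \row_l chebU theta l.
pose E : 'rV[R]_m.+1 := \row_j (y j)^-2.
pose Y := diag_mx D *m Vandermonde m.+1 b *m diag_mx E.
have dY : \det Y < 0.
  rewrite !det_mulmx !det_diag -mulrA pmulr_llt0; last first.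
    apply: mulr_gt0; last by rewrite prodr_gt0 // => j _; rewrite mxE invr_gt0 exprn_gt0.
    apply: vandermonde_gt0 => i j ij; rewrite !mxE ltrN2 ltf_pV2 ?posrE //.
    by rewrite ltr_nat.
  by move: hU; congr (_ < _); apply: eq_bigr => l _; rewrite mxE.
pose rho (e : R) (i j : 'I_m.+1) : R := let tau := e * aa i / y j in
  (chebU theta m.+1 + chebU theta m * tau) / (1 + 2 * cos theta * tau + tau ^+ 2).
pose rem e (i j : 'I_m.+1) : R := aa i ^+ m.+1 * (- (y j)^-1) ^+ m.+1 * (y j)^-2 * rho e i j.
(* The remainder has order [e^(m + 1)]. Pulled back through [V] and the diagonal of the [e^l], it
   keeps a factor [e^(m + 1 - l)] with positive exponent, so [N e] tends to [Y], whose determinant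
   is negative. *)
pose N e (l j : 'I_m.+1) : R := Y l j + e ^+ (m.+1 - l) * \sum_i invmx V l i * rem e i j.
have N0 : \det (\matrix_(l, j) N 0 l j) < 0.
  rewrite (_ : \matrix_(l, j) N 0 l j = Y) //; apply/matrixP => l j.
  by rewrite mxE /N expr0n subn_eq0 leqNgt ltn_ord /= mul0r addr0.
have den_gt0 (e : R) i j : 0 <= e -> 0 < 1 + 2 * cos theta * (e * aa i / y j) + (e * aa i / y j) ^+ 2.
  rewrite le_eqVlt => /predU1P[<-|e0]; first by rewrite !mul0r mulr0 expr0n !addr0.
  have tau0 : 0 < e * aa i / y j by rewrite divr_gt0 // mulr_gt0.
  by have := Kalpha_den_gt0 a01 ltr01 tau0; rewrite expr1n mulr1.
have cN l j : (fun e => N e l j) @ (0 : R)^'+ --> N 0 l j.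
  apply: cvg_at_right_filter.
  apply: (@cvgD _ R^o); first exact: cvg_cst.
  apply: cvgM; first exact: exprn_continuous.
  apply: (@cvg_big R _ +%R 0) => [|i _]; first exact: add_continuous.
  apply: cvgM; first exact: cvg_cst.
  apply: cvgM; first exact: cvg_cst.
  have ctau : (fun e : R => e * aa i / y j) @ (nbhs (0 : R)) --> 0 * aa i / y j.
    by apply: cvgM; [apply: cvgM; [exact: cvg_id|exact: cvg_cst]|exact: cvg_cst].
  apply: cvgM; last apply: cvgV; first 1 last.
  - by rewrite gt_eqF ?den_gt0.
  - apply: (@cvgD _ R^o); first apply: (@cvgD _ R^o); first exact: cvg_cst.
      by apply: cvgM; [exact: cvg_cst|exact: ctau].
    by rewrite expr2; under eq_fun do rewrite expr2; apply: cvgM; exact: ctau.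
  apply: (@cvgD _ R^o); first exact: cvg_cst.
  by apply: cvgM; [exact: cvg_cst|exact: ctau].
have [e [e0 de]] := @filter_ex _ (0 : R)^'+ _ _
  (filterI (nbhs_right_gt (0 : R)) (cvgr_lt _ (det_cvg cN) 0 N0)).
exists (fun i => e * aa i), y; split.
- split => [i|i j ij]; first by rewrite mulr_gt0.
  by rewrite ltr_pM2l // ltr_nat.
- by split => // i j ij; rewrite ltr_nat.
pose G : 'rV[R]_m.+1 := \row_l e ^+ l.
have -> : kminor (Kalpha alpha) (fun i => e * aa i) y =
    \det (V *m diag_mx G *m \matrix_(l, j) N e l j).
  congr (\det _).
  have -> : \matrix_(l, j) N e l j = Y + \matrix_(l, j) (e ^+ (m.+1 - l) *
      (invmx V *m \matrix_(i, j) rem e i j) l j).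
    apply/matrixP => l j; rewrite !mxE /N; congr (_ + _ * _).
      by rewrite mxE.
    by apply: eq_bigr => i _; rewrite mxE.
  rewrite mulmxDr.
  have -> : V *m diag_mx G *m \matrix_(l, j) (e ^+ (m.+1 - l) *
      (invmx V *m \matrix_(i, j) rem e i j) l j) = e ^+ m.+1 *: \matrix_(i, j) rem e i j.
    rewrite -mulmxA.
    have -> : diag_mx G *m \matrix_(l, j) (e ^+ (m.+1 - l) *
      (invmx V *m \matrix_(i, j) rem e i j) l j) =
       e ^+ m.+1 *: (invmx V *m \matrix_(i, j) rem e i j).
      apply/matrixP => l j; rewrite mul_diag_mx !mxE mulrA -exprD subnKC //.
      exact: ltnW.
    by rewrite -scalemxAr mulKVmx.
  apply/matrixP => i j; rewrite !mxE.
  have dne : 1 + 2 * cos theta * (e * aa i / y j) + (e * aa i / y j) ^+ 2 != 0.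
    by rewrite gt_eqF // den_gt0 // ltW.
  have yne : y j != 0 by rewrite gt_eqF.
  have -> : Kalpha alpha (e * aa i) (y j) = (y j)^-2 *
     (1 + 2 * cos theta * (e * aa i / y j) + (e * aa i / y j) ^+ 2)^-1.
    move: (y j) (aa i) yne => v u v0.
    rewrite -invfM /Kalpha -/theta; congr (_^-1); field; exact: v0.
  rewrite (chebU_series m s0 dne) mulrDr; congr (_ + _); last first.
    rewrite /rem /rho.
    have -> : - (e * aa i / y j) = e * (aa i * (- (y j)^-1)) by ring.
    rewrite !exprMn; ring.
  rewrite mulr_sumr; apply: eq_bigr => l _.
  rewrite mul_mx_diag /Y mul_mx_diag mul_diag_mx !mxE.
  have -> : - (e * aa i / y j) = e * (aa i * (- (y j)^-1)) by ring.
  rewrite !exprMn; ring.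
rewrite !det_mulmx det_diag pmulr_rlt0 //.
apply: mulr_gt0 => //; apply: prodr_gt0 => l _; by rewrite mxE exprn_gt0.
Qed.
End NegativeMinor.

(** * Sign regularity, and the necessary condition on [alpha] *)

Section Signs.
Variables (R : realType).

Lemma SR_TP (alpha : R) n : 0 <= alpha < 1 -> SR (Kalpha alpha) n -> TP (Kalpha alpha) n.
Proof.
move=> a01 [eps [heps hSR]] m mn x y hx hy.
have [z hz zpos] := @geometric_minor_gt0 R alpha m a01.
have := hSR m mn z z hz hz; have := hSR m mn x y hx hy.
case: (heps m) => ->; rewrite ?mul1r // mulN1r => _.
by rewrite mulN1r oppr_ge0 leNgt zpos.
Qed.

Lemma TP_SR (K : R -> R -> R) n : TP K n -> SR K n.
Proof.
move=> hTP; exists (fun=> 1); split; first by left.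
by move=> m mn x y hx hy; rewrite mul1r; exact: hTP.
Qed.

Lemma admissible_invn (alpha : R) k n : (2 <= k)%N -> alpha = k%:R^-1 ->
  admissible (pi * alpha) n.
Proof.
move=> k2 ->; constructor 3; have k0 : (0 < k)%N := ltnW k2.
split; first by rewrite mulr_gt0 ?pi_gt0 // invr_gt0 ltr0n.
by exists k => //; rewrite mulrCA divff ?mulr1 // pnatr_eq0 -lt0n.
Qed.

Lemma TP_necessary (alpha : R) n : 0 <= alpha < 1 -> (2 <= n)%N -> TP (Kalpha alpha) n ->
  (exists k : nat, (2 <= k <= n)%N /\ alpha = (k%:R)^-1) \/ alpha < (n%:R)^-1.
Proof.
move=> /andP[a0 a1] n2 hTP.
have n0 : 0 < n%:R :> R by rewrite ltr0n ltnW.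
case: (ltP alpha n%:R^-1) => [|na]; first by right.
left; case: (pselect (exists k : nat, (2 <= k <= n)%N /\ alpha = (k%:R)^-1)) => // hk; exfalso.
have an : n%:R^-1 < alpha.
  rewrite lt_neqAle na andbT; apply/eqP => E; apply: hk; exists n.
  by rewrite n2 leqnn E.
have a_gt0 : 0 < alpha by apply: lt_trans an; rewrite invr_gt0.
have hn : 1 < n%:R * alpha by rewrite -ltr_pdivrMl // mulr1.
have ex : exists m, 1 < m%:R * alpha by exists n.
case: (ex_minnP ex) => m hm mmin.
have mn : (m <= n)%N := mmin n hn.
case: m hm mmin mn => [|[|m]] hm mmin mn.
- by move: hm; rewrite mul0r ltr10.
- by move: hm; rewrite mul1r ltNge (ltW a1).
(* The least integer is now [m.+2], so minimality gives [<=]. Equality would make [alpha] one of the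
   excluded reciprocals, or [1] if [m = 0]. *)
have hm1 : m.+1%:R * alpha < 1.
  rewrite lt_neqAle; apply/andP; split; last first.
    by rewrite leNgt; apply/negP => /mmin; rewrite ltnn.
  apply/eqP => E; have aE : alpha = m.+1%:R^-1.
    by apply: (mulfI (_ : m.+1%:R != 0)); rewrite ?pnatr_eq0 // E divff // pnatr_eq0.
  case: m {hm mmin} mn E aE => [|m] mn E aE.
    by move: a1; rewrite aE invr1 ltxx.
  by apply: hk; exists m.+2; split => //; exact: ltnW.
have st : 0 < sin (pi * alpha).
  by rewrite sin_gt0_pi // mulr_gt0 ?pi_gt0 //= gtr_pMr ?pi_gt0.
have sin_pos l : (l < m.+1)%N -> 0 < chebU (pi * alpha) l.
  move=> lm; rewrite /chebU divr_gt0 // sin_gt0_pi // mulrCA.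
  rewrite mulr_gt0 ?pi_gt0 ?mulr_gt0 ?ltr0n //= gtr_pMr ?pi_gt0 //.
  by apply: le_lt_trans hm1; rewrite ler_pM2r // ler_nat.
(* The angle [(m + 2) pi alpha] exceeds [pi] and stays below [2 pi], because [(m + 1) alpha < 1] and
   [alpha < 1]. *)
have sin_neg : chebU (pi * alpha) m.+1 < 0.
  rewrite /chebU pmulr_llt0 ?invr_gt0 //.
  have -> : m.+2%:R * (pi * alpha) = (m.+2%:R * alpha - 1) * pi + pi by ring.
  rewrite sinDpi oppr_lt0 sin_gt0_pi // mulr_gt0 ?pi_gt0 ?subr_gt0 //=.
  rewrite gtr_pMl ?pi_gt0 //; move: hm1 a1; rewrite -[m.+2%:R]natr1 mulrDl mul1r; lra.
have [|x [y [hx hy]]] := @small_nodes_minor_lt0 R alpha m.+1 (introT andP (conj a_gt0 a1)).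
  rewrite big_ord_recr /= pmulr_rlt0 // prodr_gt0 // => l _; exact: sin_pos.
by rewrite ltNge hTP.
Qed.

End Signs.

Theorem mainTheorem1 (R : realType) (alpha : R) :
  0 <= alpha -> alpha < 1 ->
  (* (a) *)
  ((STPinf (Kalpha alpha) <-> SRinf (Kalpha alpha)) /\
   (SRinf (Kalpha alpha) <->
      (alpha = 0 \/ exists k : nat, (2 <= k)%N /\ alpha = (k%:R)^-1))) /\
  (* (b) *)
  (forall n : nat, (2 <= n)%N ->
     (TP (Kalpha alpha) n <-> SR (Kalpha alpha) n) /\
     (SR (Kalpha alpha) n ->
        (exists k : nat, (2 <= k <= n)%N /\ alpha = (k%:R)^-1) \/
        alpha < (n%:R)^-1)) /\
  (* (c) *)
  (forall n : nat, (2 <= n)%N ->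
     alpha <= (n%:R)^-1 ->
     ((n%:R : R) ^+ 2 - n%:R - 6 <= 0 \/ alpha <= ((n%:R : R) ^+ 2 - n%:R - 6)^-1) ->
     STP (Kalpha alpha) n).
Proof.
move=> a0 a1; have a01 : 0 <= alpha < 1 by rewrite a0.
have bnec n : (2 <= n)%N -> SR (Kalpha alpha) n ->
    (exists k : nat, (2 <= k <= n)%N /\ alpha = (k%:R)^-1) \/ alpha < (n%:R)^-1.
  by move=> n2 /(SR_TP a01); exact: TP_necessary.
have STP_SR : STPinf (Kalpha alpha) -> SRinf (Kalpha alpha).
  move=> h; exists (fun=> 1); split; first by left.
  by move=> m m1 x y hx hy; rewrite mul1r ltW //; exact: h.
have SR_par : SRinf (Kalpha alpha) ->
    alpha = 0 \/ exists k : nat, (2 <= k)%N /\ alpha = (k%:R)^-1.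
  move=> [eps [heps h]].
  have [->|an0] := eqVneq alpha 0; [by left|right].
  have a_gt0 : 0 < alpha by rewrite lt_neqAle eq_sym an0.
  (* Large enough for [1 / n < alpha], which rules out the second alternative of (b), and visibly at
     least [2]. *)
  pose n := (Num.truncn alpha^-1).+2.
  have hn : n%:R^-1 < alpha.
    rewrite -[alpha]invrK ltf_pV2 ?posrE ?invr_gt0 // ?ltr0n //.
    by apply: lt_trans (truncnS_gt _) _; rewrite ltr_nat.
  have [//|[k [/andP[k2 _] ak]]|] := bnec n isT; last by rewrite ltNge (ltW hn).
    by exists eps; split => // m /andP[m1 _]; exact: h.
  by exists k.
have par_STP : (alpha = 0 \/ exists k : nat, (2 <= k)%N /\ alpha = (k%:R)^-1) ->
    STPinf (Kalpha alpha).
  move=> hpar m m1; apply: (@STP_admissible R alpha m a01) => //; last by rewrite m1 leqnn.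
  case: hpar => [->|[k [k2 ak]]]; first by constructor 1; rewrite mulr0.
  exact: admissible_invn ak.
split.
  by split; [split=> [/STP_SR|/SR_par/par_STP]|split=> [/SR_par|/par_STP/STP_SR]].
split=> n n2; first by split; [split; [exact: TP_SR|exact: SR_TP]|exact: bnec].
move=> an _; apply: STP_admissible => //.
have [->|an0] := eqVneq alpha 0; first by constructor 1; rewrite mulr0.
have a_gt0 : 0 < alpha by rewrite lt_neqAle eq_sym an0.
(* Equality is the case [theta = pi / n] of [admissible]; strict inequality gives [n theta < pi]. *)
move: an; rewrite le_eqVlt => /predU1P[aE|an]; first exact: admissible_invn aE.
constructor 2; split; first by rewrite mulr_gt0 ?pi_gt0.
have n0 : 0 < n%:R :> R by rewrite ltr0n ltnW.
by rewrite mulrCA gtr_pMr ?pi_gt0 // mulrC -ltr_pdivlMr // div1r.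
Qed.
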